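(* Let $3\le n\le\infty$ and let $1\le\mathrm{Sym}(n)$ be the trivial permutation group of $[n]$. The Schur multiplier $\mathrm{H}_2(\mathcal{K}(1),\mathbf{Z})$ of the (abstract) kaleidoscopic group $\mathcal{K}(1)\le\mathrm{Homeo}(D_n)$ with trivial local action on $[n]$ has rank at least $(n-1)(n-2)/2$ (to be read as $\infty$ when $n=\infty$).
   Context: A dendrite is a locally connected continuum (non-empty compact connected metrizable space) containing no simple closed curve. Any two distinct points $x,y$ of a dendrite $X$ are joined by a unique arc $[x,y]$; put $(x,y)=[x,y]\setminus\{x,y\}$. For $x\in X$, $\widehat{x}=\pi_0(X\setminus\{x\})$ is the (at most countable) set of components of $X\setminus\{x\}$; $x$ is a branch point if $|\widehat{x}|\ge 3$, and $\mathrm{Br}(X)$ is the (at most countable) set of branch points. For $3\le n\le\infty$ ($\infty$ meaning countably infinite), the Ważewski dendrite $D_n$ is the dendrite, unique up to homeomorphism, which is not a single point, in which $|\widehat{x}|=n$ for every branch point $x$, and in which $(x,y)$ contains a branch point for all $x\ne y$. Write $[n]=\{m\in\mathbf{N}: m<n\}$ (so $[\infty]=\mathbf{N}\ni 0$) and $\mathrm{Sym}(n)$ for the group of all permutations of $[n]$. A coloring of $D_n$ is a map $c$ from $\widehat{D_n}=\bigsqcup_{x\in\mathrm{Br}(D_n)}\widehat{x}$ to $[n]$ whose restriction $c_x=c|_{\widehat{x}}$ is a bijection $\widehat{x}\to[n]$ for each $x\in \mathrm{Br}(D_n)$; for $y\ne x$, $c_x(y)$ denotes the color of the component of $D_n\setminus\{x\}$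 containing $y$. The coloring is kaleidoscopic if for all distinct $x,y\in\mathrm{Br}(D_n)$ and all distinct $i,j\in[n]$ there is $z\in(x,y)\cap\mathrm{Br}(D_n)$ with $c_z(x)=i$ and $c_z(y)=j$. For $g\in\mathrm{Homeo}(D_n)$ and $x\in\mathrm{Br}(D_n)$ put $\sigma_c(g,x)=c_{g(x)}\circ g\circ c_x^{-1}\in\mathrm{Sym}(n)$, where $g$ is viewed as a bijection $\widehat{x}\to\widehat{g(x)}$. For $\Gamma\le\mathrm{Sym}(n)$ put $\mathcal{K}_c(\Gamma)=\{g\in\mathrm{Homeo}(D_n):\sigma_c(g,x)\in\Gamma\ \text{for all } x\in\mathrm{Br}(D_n)\}$; thus $\mathcal{K}_c(1)$ is the group of homeomorphisms preserving the coloring $c$. Kaleidoscopic colorings exist and for any two of them, $c$ and $d$, the groups $\mathcal{K}_c(\Gamma)$ and $\mathcal{K}_d(\Gamma)$ are conjugate in $\mathrm{Homeo}(D_n)$; $\mathcal{K}(\Gamma)$ denotes $\mathcal{K}_c(\Gamma)$ for some (any) kaleidoscopic coloring $c$. The rank of an abelian group $A$ is $\dim_{\mathbf{Q}}(A\otimes_{\mathbf{Z}}\mathbf{Q})$. *)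

(* Defs.v *)
From HB Require Import structures.
From mathcomp Require Import all_boot all_order all_algebra.
From mathcomp Require Import all_classical all_reals all_analysis.
From mathcomp Require Import freeg ring.

Set Implicit Arguments.
Unset Strict Implicit.
Unset Printing Implicit Defensive.

Import Order.TTheory GRing.Theory Num.Theory.
Import numFieldNormedType.Exports.

Local Open Scope classical_set_scope.
Local Open Scope card_scope.
Local Open Scope ring_scope.

(* [None] stands for infinity. *)
Definition enat := option nat.

Definition enat_le (m n : enat) : bool :=
  match m, n with
  | _, None => true
  | None, Some _ => false
  | Some a, Some b => (a <= b)%N
  end.

(* The set [n] = {m | m < n}, as a predicate and as a type. *)
Definition below (n : enat) : pred nat :=
  fun m => if n is Some k then (m < k)%N else true.

Definition color (n : enat) : Type := {m : nat | below n m}.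
HB.instance Definition _ (n : enat) := Choice.on (color n).

Section Subgroup.
Variables (G : groupType) (S : {pred G}) (S_closed : group_closed S).

Let S1 : 1%g \in S := S_closed.1.
Let SM : mulg_closed S := group_closedM S_closed.
Let SV : invg_closed S := group_closedV S_closed.

Definition group_of_closed : groupClosed G :=
  HB.pack_for (groupClosed G) (S : G -> bool) (isMul1Closed.Build G S S1)
    (isMulClosed.Build G S SM) (isInvClosed.Build G S SV).
End Subgroup.

Section SubgroupType.
Variables (G : groupType) (S : groupClosed G).

Record subgroup := Subgroup { sg_val :> G; sg_valP : sg_val \in S }.

HB.instance Definition _ := [isSub for sg_val].
HB.instance Definition _ := [Choice of subgroup by <:].

Fact subgroup_closed : group_closed S.
Proof. by split=> [|x y xS yS]; [exact: gpred1|exact: gpredF]. Qed.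

HB.instance Definition _ :=
  SubChoice_isSubGroup.Build G _ subgroup subgroup_closed.
End SubgroupType.

Section TrivialSubgroup.
Variable G : groupType.

Fact trivial_closed : group_closed (pred1 (1%g : G)).
Proof.
by split=> [|x y /eqP -> /eqP ->]; rewrite ?divgg; exact: eqxx.
Qed.

Definition trivial_subgroup : groupClosed G := group_of_closed trivial_closed.
End TrivialSubgroup.

(* The product is composition of functions: (f * g) x = f (g x). *)
Section Sym.
Variable T : choiceType.

Record Sym := MkSym { sym_fun :> T -> T; symP : `[< bijective sym_fun >] }.

HB.instance Definition _ := [isSub for sym_fun].
HB.instance Definition _ := [Choice of Sym by <:].

Lemma sym_eqP (f g : Sym) : sym_fun f =1 sym_fun g -> f = g.
Proof. by move=> fg; apply/val_inj/funext. Qed.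

Definition sym_one : Sym := MkSym (asboolT (Bijective (frefl id) (frefl id))).

Definition sym_mul (f g : Sym) : Sym :=
  MkSym (asboolT (bij_comp (asboolW (symP f)) (asboolW (symP g)))).

Fact sym_inv_subproof (f : Sym) : exists g : T -> T, cancel (sym_fun f) g /\ cancel g (sym_fun f).
Proof. by have [g fK gK] := asboolW (symP f); exists g. Qed.

Definition sym_inv (f : Sym) : Sym :=
  let: exist _ h := cid (sym_inv_subproof f) in
  MkSym (asboolT (Bijective h.2 h.1)).

Lemma sym_invK f : cancel (sym_fun f) (sym_inv f).
Proof. by rewrite /sym_inv; case: cid => g []. Qed.
Lemma sym_Kinv f : cancel (sym_inv f) (sym_fun f).
Proof. by rewrite /sym_inv; case: cid => g []. Qed.

Fact sym_mulA : associative sym_mul. Proof. by move=> f g h; exact: sym_eqP. Qed.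
Fact sym_mul1 : left_id sym_one sym_mul. Proof. by move=> f; exact: sym_eqP. Qed.
Fact sym_mulr1 : right_id sym_one sym_mul.
Proof. by move=> f; exact: sym_eqP. Qed.
Fact sym_mulV : left_inverse sym_one sym_inv sym_mul.
Proof. by move=> f; apply: sym_eqP => x /=; rewrite sym_invK. Qed.
Fact sym_mulrV : right_inverse sym_one sym_inv sym_mul.
Proof. by move=> f; apply: sym_eqP => x /=; rewrite sym_Kinv. Qed.

HB.instance Definition _ :=
  isGroup.Build Sym sym_mulA sym_mul1 sym_mulr1 sym_mulV sym_mulrV.

Lemma sym1E x : (1%g : Sym) x = x. Proof. by []. Qed.
Lemma symME (f g : Sym) x : (f * g)%g x = f (g x). Proof. by []. Qed.
Lemma symVK (f : Sym) : cancel (sym_fun f) (f^-1)%g. Proof. exact: sym_invK. Qed.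
Lemma symKV (f : Sym) : cancel (f^-1)%g (sym_fun f). Proof. exact: sym_Kinv. Qed.
End Sym.

Section Homeo.
Variable X : topologicalType.

Definition homeo_pred : {pred Sym X} :=
  fun f => `[< continuous f /\ continuous (f^-1)%g >].

Fact homeo_closed : group_closed homeo_pred.
Proof.
split=> [|f g /asboolP[fc fVc] /asboolP[gc gVc]]; apply/asboolP.
  by rewrite invg1; split=> x A.
rewrite invgF; split=> x; first exact: continuous_comp (gVc x) (fc _).
exact: continuous_comp (fVc x) (gc _).
Qed.

Definition Homeo := subgroup (group_of_closed homeo_closed).
HB.instance Definition _ := monoid.Group.on Homeo.

Definition homeo_fun (g : Homeo) : X -> X := sg_val g.
Coercion homeo_fun : Homeo >-> Funclass.

Lemma homeoVK (g : Homeo) : cancel (homeo_fun g) (homeo_fun (g^-1)%g).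
Proof. by move=> x; exact: (symVK (sg_val g)). Qed.
Lemma homeoKV (g : Homeo) : cancel (homeo_fun (g^-1)%g) (homeo_fun g).
Proof. by move=> x; exact: (symKV (sg_val g)). Qed.
Lemma homeo_continuous (g : Homeo) : continuous g.
Proof. by have /asboolP[] := sg_valP g. Qed.
End Homeo.

Definition metrizable (R : realType) (X : topologicalType) : Prop :=
  exists (M : metricType R) (f : X -> M) (g : M -> X),
    [/\ cancel f g, cancel g f, continuous f & continuous g].

Definition locally_connected (X : topologicalType) : Prop :=
  forall (x : X) (U : set X), nbhs x U ->
    exists V : set X, [/\ open V, V x, connected V & V `<=` U].

(* In a compact Hausdorff space the two definitions below do describe the
   subspaces homeomorphic to [0, 1] and to the circle: a continuous injection of
   a compact space into a Hausdorff one is a homeomorphism onto its image. *)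
Definition is_arc (R : realType) (X : topologicalType) (x y : X)
    (A : set X) : Prop :=
  exists f : R -> X,
    [/\ {within `[0, 1]%classic, continuous f}, {in `[0, 1] &, injective f},
        f 0 = x, f 1 = y & f @` `[0, 1]%classic = A].

Definition simple_closed_curve (R : realType) (X : topologicalType)
    (C : set X) : Prop :=
  exists f : R -> X,
    [/\ {within `[0, 1]%classic, continuous f}, {in `[0, 1[ &, injective f},
        f 0 = f 1 & f @` `[0, 1]%classic = C].

Definition dendrite (R : realType) (X : topologicalType) : Prop :=
  [/\ [set: X] !=set0, compact [set: X], connected [set: X] & metrizable R X]
  /\ locally_connected X
  /\ ~ (exists C : set X, simple_closed_curve R C).

(* The arc [x, y]. In a dendrite there is exactly one arc joining two distinct
   points. *)
Definition arc (R : realType) (X : topologicalType) (x y : X) : set X :=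
  xget set0 [set A | is_arc R x y A].

Definition open_arc (R : realType) (X : topologicalType) (x y : X) : set X :=
  arc R x y `\` [set x; y].

Section Branches.
Variable X : topologicalType.

(* The component of X \ {x} containing y (for y != x). *)
Definition branch_at (x y : X) : set X := connected_component (~` [set x]) y.

(* The set \hat{x} of components of X \ {x}. *)
Definition branches (x : X) : set (set X) := branch_at x @` ~` [set x].

Definition branch_point (x : X) : Prop := (`I_3 #<= branches x).
End Branches.

Definition wazewski_dendrite (R : realType) (n : enat) (X : topologicalType)
    : Prop :=
  [/\ dendrite R X,
      exists x y : X, x <> y,
      forall x : X, branch_point x -> branches x #= [set m | below n m] &
      forall x y : X, x <> y ->
        exists z : X, open_arc R x y z /\ branch_point z].

(* [c x C] is meaningful only when [x] is a branch point and [C] is a component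
   of X \ {x}. *)
Record coloring (X : topologicalType) (n : enat) := Coloring {
  coloring_fun :> X -> set X -> color n;
  coloring_bij : forall x : X, branch_point x ->
    set_bij (branches x) [set: color n] (coloring_fun x) }.

Definition kaleidoscopic (R : realType) (X : topologicalType) (n : enat)
    (c : coloring X n) : Prop :=
  forall x y : X, branch_point x -> branch_point y -> x <> y ->
  forall i j : color n, i <> j ->
  exists z : X, [/\ open_arc R x y z, branch_point z,
    c z (branch_at z x) = i & c z (branch_at z y) = j].

Section HomeoBranches.
Variable X : topologicalType.

Lemma homeo_image_branch (g : Homeo X) (x y : X) :
  y <> x -> g @` branch_at x y = branch_at (g x) (g y).
Proof.
have sub (h : Homeo X) (a b : X) : b <> a ->
    h @` branch_at a b `<=` branch_at (h a) (h b).
  move=> ab; apply: connected_component_max.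
  - by exists b => //; exact: connected_component_refl.
  - move=> _ [z Cz <-] /= hza; have := connected_component_sub Cz.
    by apply; rewrite /= -(homeoVK h z) hza homeoVK.
  - apply: connected_continuous_connected; first exact: component_connected.
    exact/continuous_subspaceT/homeo_continuous.
move=> yx; apply/seteqP; split; first exact: sub.
have gyx : g y <> g x by move/(can_inj (homeoVK g)).
move=> z Cz; exists (homeo_fun (g^-1)%g z); last exact: homeoKV.
have /(_ (homeo_fun (g^-1)%g z)) := sub (g^-1)%g _ _ gyx.
by rewrite !homeoVK; apply; exists z.
Qed.

Lemma homeo_branches (g : Homeo X) (x : X) :
  set_bij (branches x) (branches (g x)) (fun C => g @` C).
Proof.
split.
- move=> _ [y yx <-]; exists (g y); last by rewrite homeo_image_branch.
  by move=> /(can_inj (homeoVK g)).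
- move=> C D _ _ CD; apply/seteqP; split=> z Cz.
    by rewrite -(image_inj (can_inj (homeoVK g))) -CD; exists z.
  by rewrite -(image_inj (can_inj (homeoVK g))) CD; exists z.
- move=> _ [y yx <-]; have gyx : homeo_fun (g^-1)%g y <> x.
    by move=> e; apply: yx; rewrite /= -e homeoKV.
  by exists (branch_at x (homeo_fun (g^-1)%g y)); [exists (homeo_fun (g^-1)%g y)|
    rewrite homeo_image_branch// homeoKV].
Qed.

Lemma homeo_branch_point (g : Homeo X) (x : X) :
  branch_point x -> branch_point (g x).
Proof.
move=> /card_le_trans; apply.
suff : branches x #= branches (g x) by move=> /card_eqPle[].
by apply/card_set_bijP; exists (fun C => g @` C); exact: homeo_branches.
Qed.
End HomeoBranches.

Section KaleidoscopicGroup.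
Variables (X : topologicalType) (n : enat) (c : coloring X n).

(* c_{g(x)} o g o c_x^{-1}; meaningful when [x] is a branch point. *)
Definition local_action (g : Homeo X) (x : X) (i : color n) : color n :=
  c (g x) (g @` 'pinv_(fun=> set0) (branches x) (c x) i).

Definition kaleidoscopic_pred (Gamma : groupClosed (Sym (color n))) :
    {pred Homeo X} :=
  fun g => `[< forall x : X, branch_point x ->
    exists2 s : Sym (color n), s \in Gamma & local_action g x =1 s >].

Lemma local_actionE (g : Homeo X) (x : X) (C : set X) :
  branch_point x -> branches x C ->
  local_action g x (c x C) = c (g x) (g @` C).
Proof.
move=> bx xC; rewrite /local_action.
have [_ c_inj _] := coloring_bij c bx.
by rewrite pinvKV// inE.
Qed.

Lemma local_actionP (x : X) (i : color n) : branch_point x ->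
  exists2 C : set X, branches x C & i = c x C.
Proof.
move=> bx; have [_ _ /(_ i I) [C xC <-]] := coloring_bij c bx.
by exists C.
Qed.

Lemma local_action1 (x : X) (i : color n) :
  branch_point x -> local_action 1%g x i = i.
Proof.
move=> bx; have [C xC ->] := local_actionP i bx.
by rewrite local_actionE//; congr (c x _); exact: image_id.
Qed.

Lemma local_actionM (g h : Homeo X) (x : X) (i : color n) : branch_point x ->
  local_action (g * h)%g x i = local_action g (h x) (local_action h x i).
Proof.
move=> bx; have [C xC ->] := local_actionP i bx.
have [hC _ _] := homeo_branches h x.
rewrite !local_actionE//; last 2 first.
- exact: homeo_branch_point.
- exact: hC.
by rewrite -image_comp.
Qed.

Lemma kaleidoscopic_closed (Gamma : groupClosed (Sym (color n))) :
  group_closed (kaleidoscopic_pred Gamma).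
Proof.
split=> [|g h /asboolP gK /asboolP hK]; apply/asboolP => x bx.
  by exists 1%g => [|i]; [exact: gpred1|rewrite local_action1].
have byx : branch_point (homeo_fun (h^-1)%g x) by exact: homeo_branch_point.
have [s sG gs] := gK _ byx; have [t tG ht] := hK _ byx.
exists (s * t^-1)%g => [|i]; first exact: gpredF.
rewrite local_actionM// gs; congr (s _).
apply: (can_inj (symVK t)); rewrite symKV -ht -local_actionM//.
by rewrite mulgV local_action1.
Qed.

Definition kaleidoscopic_group (Gamma : groupClosed (Sym (color n))) :=
  subgroup (group_of_closed (kaleidoscopic_closed Gamma)).
HB.instance Definition _ (Gamma : groupClosed (Sym (color n))) :=
  monoid.Group.on (kaleidoscopic_group Gamma).
End KaleidoscopicGroup.

Lemma freeg_additive_eq (K : choiceType) (V : zmodType)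
    (f g : {additive {freeg K / int} -> V}) :
  (forall x : K, f << x >> = g << x >>) -> f =1 g.
Proof.
move=> fg z; rewrite -(freeg_sumE z) !raddf_sum; apply: eq_bigr => x _.
by rewrite -[coeff x z]intz -freegU_mulz !raddfMz fg.
Qed.

(* ker g / im f, for U --f--> V --g--> W. *)
Section Homology.
Variables (U V W : zmodType) (f : {additive U -> V}) (g : {additive V -> W}).

Definition ker_pred : {pred V} := fun z => g z == 0.

Fact ker_closed : zmod_closed ker_pred.
Proof.
split=> [|x y]; rewrite !unfold_in ?raddf0// => /eqP gx /eqP gy.
by rewrite raddfB gx gy subr0.
Qed.
HB.instance Definition _ := GRing.isZmodClosed.Build V ker_pred ker_closed.

Record cycle := Cycle { cycle_val :> V; _ : cycle_val \in ker_pred }.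
HB.instance Definition _ := [isSub for cycle_val].
HB.instance Definition _ := [Choice of cycle by <:].
HB.instance Definition _ := [SubChoice_isSubZmodule of cycle by <:].

Definition boundary_pred : {pred cycle} :=
  fun z => `[< exists u : U, f u = cycle_val z >].

Fact boundary_closed : zmod_closed boundary_pred.
Proof.
split=> [|x y /asboolP[u ux] /asboolP[v vy]]; apply/asboolP.
  by exists 0; rewrite raddf0.
by exists (u - v); rewrite raddfB ux vy.
Qed.
HB.instance Definition _ :=
  GRing.isZmodClosed.Build cycle boundary_pred boundary_closed.

Definition homology : Type := Quotient.quot boundary_pred.
HB.instance Definition _ := GRing.Zmodule.on homology.
End Homology.

(* The inhomogeneous bar complex of G with (trivial) integer coefficients, in
   degrees 3 -> 2 -> 1; [<< x >>] is the basis element of index x. *)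
Section GroupHomology.
Variable G : groupType.

Definition bar2 : {freeg (G * G) / int} -> {freeg G / int} :=
  fglift (fun p : G * G => << p.2 >> - << (p.1 * p.2)%g >> + << p.1 >>).

Definition bar3 : {freeg (G * G * G) / int} -> {freeg (G * G) / int} :=
  fglift (fun p : G * G * G => let: (a, b, c) := p in
    << (b, c) >> - << ((a * b)%g, c) >> + << (a, (b * c)%g) >> - << (a, b) >>).

HB.instance Definition _ :=
  GRing.isZmodMorphism.Build _ _ bar2 (lift_is_additive _).
HB.instance Definition _ :=
  GRing.isZmodMorphism.Build _ _ bar3 (lift_is_additive _).

Lemma bar23 (z : {freeg (G * G * G) / int}) : bar2 (bar3 z) = 0.
Proof.
pose zero : {freeg (G * G * G) / int} -> {freeg G / int} := \0.
apply: (freeg_additive_eq (f := bar2 \o bar3) (g := zero)) => -[[a b] c].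
rewrite /= /bar3 liftU scale1r !(raddfB, raddfD) /= /bar2 !liftU !scale1r /=.
rewrite mulgA; apply/eqP/freeg_eqP => x.
by rewrite !(coeffB, coeffD, coeff0); ring.
Qed.

Definition H2 : Type := homology bar3 bar2.
HB.instance Definition _ := GRing.Zmodule.on H2.
End GroupHomology.

Section Span.
Variables (V : zmodType) (E : set V).

Definition zspan_pred : {pred V} :=
  fun x => `[< smallest (fun S => S 0 /\ forall x y, S x -> S y -> S (x - y))
                 E x >].

Fact zspan_closed : zmod_closed zspan_pred.
Proof.
split=> [|x y /asboolP Ex /asboolP Ey]; apply/asboolP => S SE.
  by case: SE => -[].
by case: (SE) => -[_ SB] _; apply: SB; [exact: Ex|exact: Ey].
Qed.
HB.instance Definition _ := GRing.isZmodClosed.Build V zspan_pred zspan_closed.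
End Span.

Section Tensor.
Variables A B : zmodType.

Definition tensor_relations : set {freeg (A * B) / int} :=
  [set z | exists a a' b, z = << (a + a', b) >> - << (a, b) >> - << (a', b) >>]
  `|`
  [set z | exists a b b', z = << (a, b + b') >> - << (a, b) >> - << (a, b') >>].

Definition tensor : Type := Quotient.quot (zspan_pred tensor_relations).
HB.instance Definition _ := GRing.Zmodule.on tensor.
End Tensor.

(* A (x) Q as a rational vector space: r (a (x) q) = a (x) r q. *)
Section TensorRat.
Variable A : zmodType.
Local Notation F := {freeg (A * rat) / int}.
Local Notation I := (zspan_pred (@tensor_relations A rat)).

Definition tensorQ : Type := tensor A rat.
HB.instance Definition _ := GRing.Zmodule.on tensorQ.

Definition tensorQ_pi : F -> tensorQ := \pi_(Quotient.quot I)%qT.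
HB.instance Definition _ := GRing.isZmodMorphism.Build F tensorQ tensorQ_pi
  (@pi_is_zmod_morphism _ _ _ (Quotient.quot I)).

Definition free_scale (r : rat) : F -> F :=
  fglift (fun p : A * rat => << (p.1, r * p.2) >>).
HB.instance Definition _ r :=
  GRing.isZmodMorphism.Build F F (free_scale r) (lift_is_additive _).

Definition tensorQ_scale (r : rat) (t : tensorQ) : tensorQ :=
  tensorQ_pi (free_scale r (repr t)).

Lemma tensorQ_pi_eq (x y : F) :
  (tensorQ_pi x = tensorQ_pi y) <-> x - y \in I.
Proof. by rewrite Quotient.idealrBE; split=> [/eqP|/eqP]. Qed.

Lemma tensorQ_piK (t : tensorQ) : tensorQ_pi (repr t) = t.
Proof. exact: (@reprK _ (Quotient.quot I)). Qed.

Lemma zspan_gen (V : zmodType) (E : set V) (x : V) : E x -> x \in zspan_pred E.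
Proof. by move=> Ex; apply/asboolP => S [_]; apply. Qed.

Lemma free_scale_span (r : rat) (x : F) : x \in I -> free_scale r x \in I.
Proof.
move=> /asboolP /(_ [set y | free_scale r y \in I]); apply; split.
  split=> /= [|y z yI zI]; first by rewrite raddf0 rpred0.
  by rewrite raddfB rpredB.
move=> _ [[a [a' [b ->]]]|[a [b [b' ->]]]] /=; apply: zspan_gen.
  left; exists a, a', (r * b).
  by rewrite !raddfB /= /free_scale !liftU !scale1r.
right; exists a, (r * b), (r * b').
by rewrite !raddfB /= /free_scale !liftU !scale1r /= mulrDr.
Qed.

Lemma tensorQ_scaleE (r : rat) (x : F) :
  tensorQ_scale r (tensorQ_pi x) = tensorQ_pi (free_scale r x).
Proof.
apply/tensorQ_pi_eq; rewrite -raddfB; apply: free_scale_span.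
by apply/tensorQ_pi_eq; rewrite tensorQ_piK.
Qed.

Lemma free_scaleA (r s : rat) (x : F) :
  free_scale r (free_scale s x) = free_scale (r * s) x.
Proof.
apply: (freeg_additive_eq (f := free_scale r \o free_scale s)) => -[a q].
by rewrite /= /free_scale !liftU !scale1r liftU scale1r mulrA.
Qed.

Lemma free_scale1 (x : F) : free_scale 1 x = x.
Proof.
apply: (freeg_additive_eq (g := idfun)) => -[a q].
by rewrite /= /free_scale liftU scale1r mul1r.
Qed.

Lemma free_scaleD (r s : rat) (x : F) :
  tensorQ_pi (free_scale (r + s) x) =
  tensorQ_pi (free_scale r x) + tensorQ_pi (free_scale s x).
Proof.
apply: (freeg_additive_eq (f := tensorQ_pi \o free_scale (r + s))
  (g := (tensorQ_pi \o free_scale r) \+ (tensorQ_pi \o free_scale s))).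
move=> -[a q] /=; rewrite -raddfD /=; apply/tensorQ_pi_eq.
rewrite /free_scale !liftU !scale1r /= opprD addrA; apply: zspan_gen.
by right; exists a, (r * q), (s * q); rewrite mulrDl.
Qed.

Fact tensorQ_scaleA (r s : rat) (t : tensorQ) :
  tensorQ_scale r (tensorQ_scale s t) = tensorQ_scale (r * s) t.
Proof. by rewrite -[t]tensorQ_piK !tensorQ_scaleE free_scaleA. Qed.

Fact tensorQ_scale1 : left_id 1 tensorQ_scale.
Proof. by move=> t; rewrite -[t]tensorQ_piK tensorQ_scaleE free_scale1. Qed.

Fact tensorQ_scaleDr : right_distributive tensorQ_scale +%R.
Proof.
move=> r t u; rewrite -[t]tensorQ_piK -[u]tensorQ_piK -raddfD.
by rewrite !tensorQ_scaleE !raddfD.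
Qed.

Fact tensorQ_scaleDl (t : tensorQ) :
  {morph tensorQ_scale^~ t : r s / r + s}.
Proof.
by move=> r s; rewrite -[t]tensorQ_piK !tensorQ_scaleE free_scaleD.
Qed.

HB.instance Definition _ := GRing.Zmodule_isLmodule.Build rat tensorQ
  tensorQ_scaleA tensorQ_scale1 tensorQ_scaleDr tensorQ_scaleDl.
End TensorRat.

Section Dimension.
Variables (K : fieldType) (V : lmodType K).

Definition is_basis (d : nat) (v : 'I_d -> V) : Prop :=
  (forall a : 'I_d -> K, \sum_i a i *: v i = 0 -> forall i, a i = 0) /\
  (forall w : V, exists a : 'I_d -> K, w = \sum_i a i *: v i).

(* The cardinality of a finite basis if there is one, infinity otherwise. *)
Definition dimension : enat :=
  xget None [set d : enat |
    exists (k : nat) (v : 'I_k -> V), d = Some k /\ is_basis v].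
End Dimension.

Definition rank (A : zmodType) : enat := dimension (tensorQ A).

(* (n - 1)(n - 2) / 2, for n >= 1. *)
Definition half_product (n : enat) : enat :=
  if n is Some k then Some ((k - 1) * (k - 2) %/ 2)%N else None.

(* Main.v *)
Require Import Defs.
From HB Require Import structures.
From mathcomp Require Import all_boot all_order all_algebra.
From mathcomp Require Import all_classical all_reals all_analysis.
From mathcomp Require Import freeg ring lra zify.

(* Let B be the set of branch points; for b in B and a point x let col b x be the
   color of the branch of x at b, with col b b = None. The kaleidoscopic property
   makes B a tree in which b lies between x and y iff col b x <> col b y (no arc
   beyond those of the hypotheses is ever constructed), and every bijection of B
   preserving col extends to D_n by compactness. So K(1) = Aut(B, col), and a
   back-and-forth argument makes it transitive on pairs of points of given colors.

   For an alternating function h of two colors, the sum over b of the coboundaries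
   of h (col b x) (col b y) is an invariant 2-cocycle omega on B: only the centre
   of a triple contributes. To find cycles on which omega is nonzero, take p and q
   with p trivial near x, q trivial near y and pq trivial near z. An element trivial
   near a point is a commutator in the stabilizer of this point (an infinite product
   of disjoint translates), hence it bounds a chain on which omega, based at this
   point, vanishes. The three chains and the pair (p, q) form a 2-cycle of value
   omega (x, y, z) - omega (x, y, q z). One can choose p and q such that the colors
   at the centre are (i, j, k) for the first triple and (j, i, k) for the second:
   the value is 2 (h i j + h j k + h k i). For i fixed, the pairs {j, k} give
   (n - 1) (n - 2) / 2 independent classes. *)

Set Implicit Arguments.
Unset Strict Implicit.
Unset Printing Implicit Defensive.

Import Order.TTheory GRing.Theory Num.Theory.
Import numFieldNormedType.Exports.

(** * Colored trees and their homogeneity by back-and-forth *)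

Section ColoredTree.
Variables (T : eqType) (C : eqType) (col : T -> T -> option C).

(** [None] counts as a color, so the centre [m] may be one of [x], [y], [z]. *)
Definition separates3 (m x y z : T) : bool :=
  [&& col m x != col m y, col m y != col m z & col m x != col m z].

(** [col_tree] is the tree axiom: from [z], whatever lies beyond [y] is seen in the direction of
    [y]. *)
Record kaleidoscopic_tree : Prop := KaleidoscopicTree {
  col_eqNone : forall x y, (col x y == None) = (x == y);
  col_tree : forall x y z,
    y != z -> col y x != col y z -> col z x = col z y;
  col_center : forall x y z, x != y -> y != z -> x != z ->
    exists m, separates3 m x y z;
  col_kaleidoscopic : forall x y (i j : C), x != y -> i != j ->
    exists2 z, col z x = Some i & col z y = Some j;
  col_leafless : forall x (i : C), exists y, col x y = Some i;
  col_three : exists i j k : C, [&& i != j, j != k & i != k] }.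

Hypothesis tree : kaleidoscopic_tree.

Lemma col_self x : col x x = None.
Proof. by apply/eqP; rewrite (col_eqNone tree). Qed.

Lemma col_neq x y : x != y -> exists i, col x y = Some i.
Proof. by rewrite -(col_eqNone tree); case: (col x y) => // i; exists i. Qed.

Lemma col_Some_neq x y i : col x y = Some i -> x != y.
Proof. by rewrite -(col_eqNone tree) => ->. Qed.

Lemma between_trans f g u v : g != f ->
  col f v != col f u -> col g f != col g u -> col g v != col g u.
Proof.
move=> gf fvu gfu.
have [->|gu] := eqVneq g u.
  rewrite col_self (col_eqNone tree).
  by apply/eqP => uv; rewrite uv eqxx in fvu.
have fg : col f u = col f g.
  by apply: (col_tree tree) => //; rewrite eq_sym.
suff -> : col g v = col g f by [].
by apply: (col_tree tree); rewrite -?fg // eq_sym.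
Qed.

(** Closure under medians: the finite sets that serve as domains and ranges in the
    back-and-forth. *)
Definition center_closed (F : seq T) :=
  forall m x y z, x \in F -> y \in F -> z \in F -> separates3 m x y z -> m \in F.

(** An [m] outside [u :: F] sees [u] as it sees [f] or [g], whichever lies beyond [u]; a triple with
    centre [m] can thus be moved into [F]. *)
Lemma center_closed_between F u f g : center_closed F -> f \in F -> g \in F ->
  col u f != col u g -> center_closed (u :: F).
Proof.
move=> Fc fF gF ufg m x y z xF yF zF sep.
apply: contraT; rewrite inE negb_or => /andP[mu mF].
have rep w : w \in u :: F -> exists2 h, h \in F & col m w = col m h.
  rewrite inE => /predU1P[->|wF]; last by exists w.
  have um : u != m by rewrite eq_sym.
  have [ufm|ufm] := eqVneq (col u f) (col u m).
    exists g => //; apply/esym; apply: (col_tree tree) => //.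
    by rewrite -ufm eq_sym.
  by exists f => //; apply/esym; apply: (col_tree tree).
have [x' x'F ex] := rep _ xF; have [y' y'F ey] := rep _ yF.
have [z' z'F ez] := rep _ zF.
have /negP [] := mF; apply: Fc x'F y'F z'F _.
by move: sep; rewrite /separates3 ex ey ez.
Qed.

(** A centre [m] outside [u :: F] either sees [u] and [v] alike, and [v] can replace [u], or lies
    between them and then sees only two colors on [u :: F]. *)
Lemma center_closed_hang F u v : center_closed F -> v \in F ->
  {in F, forall f, col v f != col v u} -> center_closed (u :: F).
Proof.
move=> Fc vF hang m x y z xF yF zF sep.
apply: contraT; rewrite inE negb_or => /andP[mu mF].
have mv : m != v by apply: contraNneq mF => ->.
have [muv|muv] := eqVneq (col m u) (col m v).
  have rep w : w \in u :: F -> exists2 h, h \in F & col m w = col m h.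
    rewrite inE => /predU1P[->|wF]; first by exists v.
    by exists w.
  have [x' x'F ex] := rep _ xF; have [y' y'F ey] := rep _ yF.
  have [z' z'F ez] := rep _ zF.
  have /negP [] := mF; apply: Fc x'F y'F z'F _.
  by move: sep; rewrite /separates3 ex ey ez.
have vum : col v u = col v m by exact: (col_tree tree).
have two w : w \in u :: F -> (col m w == col m u) || (col m w == col m v).
  rewrite inE => /predU1P[->|wF]; first by rewrite eqxx.
  apply/orP; right; apply/eqP; apply: (col_tree tree); first by rewrite eq_sym.
  by rewrite -vum hang.
move: sep; rewrite /separates3.
by case/orP: (two _ xF) => /eqP->; case/orP: (two _ yF) => /eqP->;
  case/orP: (two _ zF) => /eqP->; rewrite ?eqxx ?andbF.
Qed.

(* Minimality for the order in which [f] precedes [v] if it lies between [v]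
   and [u]. *)
Lemma nearest (F : seq T) (P : pred T) u : has P F ->
  exists v, [/\ v \in F, P v &
    {in F, forall f, P f -> f != v -> col f v = col f u}].
Proof.
pose Q v f := [&& f != v, col f v != col f u & P f].
suff near n : forall v, v \in F -> P v -> count (Q v) F <= n ->
    exists v, [/\ v \in F, P v &
      {in F, forall f, P f -> f != v -> col f v = col f u}].
  by case/hasP => v vF Pv; exact: near vF Pv (leqnn _).
elim: n => [|n IHn] v vF Pv; have [/hasP[f fF Qf]|noQ] := boolP (has (Q v) F).
- by rewrite leqNgt -has_count; move/negP => []; apply/hasP; exists f.
- move=> _; exists v; split=> // f fF Pf fv; apply/eqP.
  move/hasPn: noQ => /(_ f fF); rewrite /Q fv Pf andbT /=.
  by rewrite negbK.
- move=> le_n; apply: (IHn f) => //; first by case/and3P: Qf.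
  have ltQ : count (Q f) F < count (Q v) F.
    have memf : 0 < count (pred1 f) F by rewrite -has_count has_pred1.
    apply: (@leq_trans (count (predU (Q f) (pred1 f)) F)).
      rewrite -[X in _ <= X]addn0.
      have -> : 0 = count (predI (Q f) (pred1 f)) F.
        apply/esym/eqP; rewrite -leqn0 leqNgt -has_count; apply/hasPn => g _.
        by rewrite /= /Q; case: eqVneq; rewrite ?andbF.
      by rewrite count_predUI -addn1 leq_add2l.
    case/and3P: Qf => fv fvu Pf.
    apply: sub_count => g /= /orP[/and3P[gf gfu Pg]|/eqP->]; last first.
      by rewrite /Q fv fvu Pf.
    rewrite /Q Pg (between_trans gf) // !andbT.
    apply: contraNneq fvu => gv; rewrite -gv in gfu gf *.
    by apply/eqP/esym; apply: (col_tree tree); rewrite // eq_sym.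
  by rewrite -ltnS; apply: leq_trans ltQ le_n.
- move=> _; exists v; split=> // f fF Pf fv; apply/eqP.
  move/hasPn: noQ => /(_ f fF); rewrite /Q fv Pf andbT /=.
  by rewrite negbK.
Qed.

(** The gate [v] is the point of this side nearest to [u]. If some [f] violated the conclusion, the
    centre of [f], [v], [u] would also be that of [f], [v], [w], hence a point of [F] between [v]
    and [u]. *)
Lemma gate_of_side (F : seq T) u w v0 : center_closed F -> u \notin F ->
  w \in F -> v0 \in F -> col u v0 != col u w ->
  exists v, [/\ v \in F, col u v = col u v0 &
    {in F, forall f, col u f = col u v0 -> col v f != col v u}].
Proof.
move=> Fc uF wF v0F v0w.
have [|v [vF /eqP uv near]] := @nearest F (fun f => col u f == col u v0) u.
  by apply/hasP; exists v0.
exists v; split=> // f fF uf.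
have uneq h : h \in F -> h != u by move=> hF; apply: contraNneq uF => <-.
have [->|fv] := eqVneq f v.
  by rewrite col_self eq_sym (col_eqNone tree) uneq.
apply/eqP => vfu.
have fvu : col f v = col f u by apply: near => //; exact/eqP.
have [m sep] := col_center tree fv (uneq _ vF) (uneq _ fF).
move: (sep); rewrite /separates3 => /and3P[mfv mvu mfu].
have mu : u != m by apply: contraNneq mfv => <-; rewrite uv uf.
have um : col u m = col u v by apply/esym; apply: (col_tree tree); rewrite // eq_sym.
have mw : col m w = col m u.
  apply: (col_tree tree) => //.
  by rewrite um uv eq_sym.
have mF : m \in F.
  by apply: Fc fF vF wF _; rewrite /separates3 mfv mw mvu mfu.
case/negP: mvu; apply/eqP; apply: near => //; first by rewrite um uv.
by apply: contraNneq mfu => ->; rewrite vfu.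
Qed.

Lemma gate_vals v f u : v != u -> v != f -> col v f != col v u ->
  col u f = col u v /\ col f u = col f v.
Proof.
by move=> vu vf vfu; split; apply: (col_tree tree); rewrite // eq_sym.
Qed.

Definition color_iso (s : seq (T * T)) :=
  {in s &, forall p q, col p.1 q.1 = col p.2 q.2}.

Definition good_iso s :=
  [/\ color_iso s, center_closed (unzip1 s) & center_closed (unzip2 s)].

Lemma color_iso_cons s u u' : color_iso s ->
  {in s, forall p, col u p.1 = col u' p.2 /\ col p.1 u = col p.2 u'} ->
  color_iso ((u, u') :: s).
Proof.
move=> s_iso uP p q; rewrite !inE => /predU1P[->|ps] /predU1P[->|qs] /=.
- by rewrite !col_self.
- by have [] := uP _ qs.
- by have [] := uP _ ps.
- exact: s_iso.
Qed.

Lemma color_iso_eq s p q : color_iso s -> p \in s -> q \in s ->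
  (p.1 == q.1) = (p.2 == q.2).
Proof. by move=> s_iso ps qs; rewrite -!(col_eqNone tree) s_iso. Qed.

(** All colors involving [u] are read through [v], so [u'] only has to lie in the right branch at
    [v'] and to see [v'] with the right color. *)
Lemma extend_hang s u v : good_iso s -> v \in unzip1 s -> u \notin unzip1 s ->
  {in unzip1 s, forall f, col v f != col v u} ->
  exists u', good_iso ((u, u') :: s).
Proof.
move=> [s_iso Fc F'c] /mapP[[v1 v'] vs /= ->{v}] uF hang.
have vu : v1 != u by apply: contraNneq uF => <-; apply/mapP; exists (v1, v').
have [k vuk] := col_neq vu; have [i uvi] : exists i, col u v1 = Some i.
  by apply: col_neq; rewrite eq_sym.
(* [w] marks the branch; [u'] is placed between [v'] and [w], with any color [j] other than [i]
   toward [w]. *)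
have [w v'w] := col_leafless tree v' k.
have [j ij] : exists j, i != j.
  have [a [b [d /and3P[ab _ _]]]] := col_three tree.
  have [ia|] := eqVneq i a; last by exists a.
  by exists b; rewrite ia.
have [u' u'v' u'w] := col_kaleidoscopic tree (col_Some_neq v'w) ij.
have v'u' : col v' u' = Some k.
  rewrite -v'w; apply/esym; apply: (col_tree tree); first exact: col_Some_neq u'v'.
  by rewrite u'v' u'w; apply: contraNneq ij => -[->].
have hang' : {in unzip2 s, forall f, col v' f != col v' u'}.
  move=> _ /mapP[p ps ->]; rewrite v'u' -vuk.
  rewrite -(s_iso (v1, v') p)//=; apply: hang; exact: map_f.
exists u'; split; first apply: color_iso_cons => // p ps.
- have [/eqP pv|pv] := eqVneq v1 p.1.
    have := pv; rewrite (color_iso_eq s_iso vs ps)//= => /eqP <-.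
    by rewrite -(eqP pv) uvi u'v' vuk v'u'.
  have p'v' : v' != p.2 by rewrite -(color_iso_eq s_iso vs ps).
  have [-> ->] := gate_vals vu pv (hang _ (map_f _ ps)).
  have [-> ->] := gate_vals (col_Some_neq v'u') p'v' (hang' _ (map_f _ ps)).
  by rewrite uvi u'v' (s_iso p (v1, v')).
- apply: (center_closed_hang Fc _ hang); exact: (map_f fst vs).
- apply: (center_closed_hang F'c _ hang'); exact: (map_f snd vs).
Qed.

(** There is a gate on either side of [u], and [u'] is placed between the images of the two gates
    with the same two colors. *)
Lemma extend_between s u f g : good_iso s ->
  f \in unzip1 s -> g \in unzip1 s -> u \notin unzip1 s ->
  col u f != col u g -> exists u', good_iso ((u, u') :: s).
Proof.
move=> [s_iso Fc F'c] fF gF uF ufg.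
have uneq h : h \in unzip1 s -> h != u by move=> hF; apply: contraNneq uF => <-.
have [_ [/mapP[[v v'] vs ->] /= uv gatev]] := gate_of_side Fc uF gF fF ufg.
have [_ [/mapP[[w w'] ws ->] /= uw gatew]] : exists w, [/\ w \in unzip1 s, col u w = col u g &
    {in unzip1 s, forall f, col u f = col u g -> col w f != col w u}].
  by apply: gate_of_side Fc uF fF gF _; rewrite eq_sym.
have vF : v \in unzip1 s by exact: (map_f fst vs).
have wF : w \in unzip1 s by exact: (map_f fst ws).
have [i ufi] : exists i, col u f = Some i by apply: col_neq; rewrite eq_sym uneq.
have [j ugj] : exists j, col u g = Some j by apply: col_neq; rewrite eq_sym uneq.
have ij : i != j by apply: contraNneq ufg => e; rewrite ufi ugj e.
have vw : v' != w'.
  rewrite -(color_iso_eq s_iso vs ws)/=.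
  by apply: contraNneq ufg => e; rewrite -uv -uw e.
have [u' u'v u'w] := col_kaleidoscopic tree vw ij.
(* Points on the side of the gate [a] and [u] see each other through [a]; the other gate [b] gives
   the color of [u] at [a]. *)
have side a a' b b' k : (a, a') \in s -> (b, b') \in s ->
    col u a = Some k -> col u' a' = Some k -> col u a != col u b -> col u' a' != col u' b' ->
    {in unzip1 s, forall h, col u h = Some k -> col a h != col a u} ->
    {in s, forall p, col u p.1 = Some k -> col u p.1 = col u' p.2 /\ col p.1 u = col p.2 u'}.
  move=> as_ bs ua u'a' uab u'ab gatea p ps up.
  have au : col a u = col a b.
    apply/esym; apply: (col_tree tree); first exact: col_Some_neq ua.
    by rewrite eq_sym.
  have a'u' : col a' u' = col a' b'.
    apply/esym; apply: (col_tree tree); first exact: col_Some_neq u'a'.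
    by rewrite eq_sym.
  have aua'u' : col a u = col a' u' by rewrite au a'u' (s_iso (a, a') (b, b')).
  have [/eqP pa|pa] := eqVneq a p.1.
    have := pa; rewrite (color_iso_eq s_iso as_ ps)//= => /eqP <-.
    by rewrite -(eqP pa) ua u'a'.
  have p'a' : a' != p.2 by rewrite -(color_iso_eq s_iso as_ ps).
  have apu : col a p.1 != col a u by apply: gatea => //; exact: map_f.
  have a'pu : col a' p.2 != col a' u' by rewrite -(s_iso (a, a') p)//= -aua'u'.
  have au_ : a != u by rewrite eq_sym (col_Some_neq ua).
  have a'u'_ : a' != u' by rewrite eq_sym (col_Some_neq u'a').
  have [-> ->] := gate_vals au_ pa apu.
  have [-> ->] := gate_vals a'u'_ p'a' a'pu.
  by rewrite ua u'a' (s_iso p (a, a')).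
have ij' : Some i != Some j :> option C by apply: contraNneq ij => -[->].
have ji' : Some j != Some i :> option C by rewrite eq_sym.
exists u'; split; first apply: color_iso_cons => // p ps.
- have [upi|upi] := eqVneq (col u p.1) (Some i).
    apply: (side v v' w w' i) => //; rewrite ?uv ?uw ?u'v ?u'w ?ufi ?ugj//.
    by move=> h hF; rewrite -ufi; exact: gatev.
  have [upj|upj] := eqVneq (col u p.1) (Some j).
    apply: (side w w' v v' j) => //; rewrite ?uv ?uw ?u'v ?u'w ?ufi ?ugj//.
    by move=> h hF; rewrite -ugj; exact: gatew.
  (* A third color at [u] would make [u] a centre of points of the domain. *)
  have pF : p.1 \in unzip1 s by exact: map_f.
  case/negP: uF; apply: Fc pF fF gF _.
  by rewrite /separates3 ufi ugj upi ij' upj.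
- exact: center_closed_between Fc fF gF ufg.
- apply: (center_closed_between (f := v') (g := w') F'c).
  + exact: (map_f snd vs).
  + exact: (map_f snd ws).
  + by rewrite u'v u'w.
Qed.

(** If [u] neither lies between two points of the domain nor hangs at the nearest one, it branches
    off at a point [m] between two points of the domain; [m] is added first, and [u] then hangs at
    [m]. *)
Lemma extend_domain s u : good_iso s -> s != [::] ->
  exists s', [/\ good_iso s', {subset s <= s'} & u \in unzip1 s'].
Proof.
move=> s_good s0; have [s_iso Fc F'c] := s_good.
have [uF|uF] := boolP (u \in unzip1 s); first by exists s; split.
suff [s' [s'_good ss' [u' u's']]] : exists s', [/\ good_iso s', {subset s <= s'} &
    exists u', good_iso ((u, u') :: s')].
  exists ((u, u') :: s'); split; rewrite ?inE ?eqxx// => p /ss'.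
  by rewrite inE => ->; rewrite orbT.
have uneq h : h \in unzip1 s -> h != u by move=> hF; apply: contraNneq uF => <-.
have [[f [g [fF gF ufg]]]|const] := pselect (exists f g,
    [/\ f \in unzip1 s, g \in unzip1 s & col u f != col u g]).
  by exists s; split=> //; exact: (extend_between s_good fF gF uF ufg).
have same f g : f \in unzip1 s -> g \in unzip1 s -> col u f = col u g.
  move=> fF gF; apply/eqP; apply: contrapT => /negP ufg; apply: const.
  by exists f, g.
have [v [vF _ near]] : exists v, [/\ v \in unzip1 s, xpredT v &
    {in unzip1 s, forall f, xpredT f -> f != v -> col f v = col f u}].
  by apply: nearest; rewrite has_predT size_map lt0n size_eq0.
have [hang|nhang] := pselect {in unzip1 s, forall f, col v f != col v u}.
  by exists s; split=> //; exact: (extend_hang s_good vF uF hang).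
have [f [fF /eqP vfu]] : exists f, f \in unzip1 s /\ col v f == col v u.
  apply: contrapT => H; apply: nhang => f fF; apply/negP => vfu.
  by apply: H; exists f.
have fv : f != v.
  apply/negP => /eqP e; move/eqP: vfu; rewrite e col_self eq_sym.
  by rewrite (col_eqNone tree) (negPf (uneq _ vF)).
have [m sep] := col_center tree fv (uneq _ vF) (uneq _ fF).
move: (sep); rewrite /separates3 => /and3P[mfv mvu mfu].
have mv : m != v by apply: contraNneq mfu => ->; rewrite vfu.
have mu : u != m by apply: contraNneq mfv => <-; rewrite (same _ _ fF vF).
have mF : m \notin unzip1 s.
  by apply: contraNN mvu => mF; rewrite (near m).
have [m' s1_good] := extend_between s_good fF vF mF mfv.
exists ((m, m') :: s); split=> //.
  by move=> p ps; rewrite inE ps orbT.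
apply: (@extend_hang _ u m) => //=; rewrite ?inE ?eqxx//.
  by rewrite (negPf mu).
move=> g; rewrite inE => /predU1P[->|gF].
  by rewrite col_self eq_sym (col_eqNone tree) eq_sym.
(* A point [g] of the domain seen from [m] like [u] would make [m] the centre of [f], [v], [g]. *)
apply: contraNneq mF => mgu; apply: Fc fF vF gF _.
by rewrite /separates3 mfv mgu mvu mfu.
Qed.

Definition swap_iso (s : seq (T * T)) := [seq (p.2, p.1) | p <- s].

Lemma mem_swap_iso s p : (p \in swap_iso s) = ((p.2, p.1) \in s).
Proof.
by apply/mapP/idP => [[q qs ->]|ps]; [case: q qs|exists (p.2, p.1) => //; case: (p)].
Qed.

Lemma good_swap_iso s : good_iso s -> good_iso (swap_iso s).
Proof.
case=> s_iso Fc F'c; split.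
- by move=> p q; rewrite !mem_swap_iso => ps qs; rewrite (s_iso _ _ ps qs).
- by rewrite /unzip1 /swap_iso -map_comp.
- by rewrite /unzip2 /swap_iso -map_comp.
Qed.

Lemma extend_both s u : good_iso s -> s != [::] ->
  exists s', [/\ good_iso s', {subset s <= s'}, u \in unzip1 s' & u \in unzip2 s'].
Proof.
move=> s_good s0; have [s1 [s1_good ss1 us1]] := extend_domain u s_good s0.
have s1_0 : swap_iso s1 != [::].
  by case: (s) s0 ss1 => // p ? _ /(_ p); rewrite inE eqxx => /(_ isT); case: (s1).
have [s2 [s2_good ss2 us2]] := extend_domain u (good_swap_iso s1_good) s1_0.
have sub : {subset s1 <= swap_iso s2}.
  by move=> p ps; rewrite mem_swap_iso; apply: ss2; rewrite mem_swap_iso; case: p ps.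
exists (swap_iso s2); split.
- exact: good_swap_iso.
- by move=> p /ss1 /sub.
- by case/mapP: us1 => p /sub ps ->; exact: map_f.
- by rewrite /unzip2 /swap_iso -map_comp.
Qed.

(** The map is the union of an increasing chain of finite isomorphisms, the one of index [k.+1]
    having [e k] in its domain and in its range. *)
Theorem back_and_forth (e : nat -> T) (e_surj : forall x, exists k, e k = x) s :
  good_iso s -> s != [::] ->
  exists f g : T -> T, [/\ cancel f g, cancel g f,
    forall x y, col (f x) (f y) = col x y & {in s, forall p, f p.1 = p.2}].
Proof.
move=> s_good s0.
pose good := {s' | good_iso s' /\ s' != [::]}.
have next (k : nat) (s1 : good) : {s2 : good | [/\ {subset sval s1 <= sval s2},
    e k \in unzip1 (sval s2) & e k \in unzip2 (sval s2)]}.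
  apply: cid; case: s1 => s1 [s1_good s1_0] /=.
  have [s2 [s2_good s12 ? ?]] := extend_both (e k) s1_good s1_0.
  suff s2_0 : s2 != [::] by exists (exist _ s2 (conj s2_good s2_0)).
  by case: (s1) s1_0 s12 => // p ? _ /(_ p); rewrite inE eqxx => /(_ isT); case: (s2).
pose S := fix S k : good := if k is k'.+1 then sval (next k' (S k'))
                            else exist _ s (conj s_good s0).
have S_incr k l : k <= l -> {subset sval (S k) <= sval (S l)}.
  elim: l => [|l IHl]; first by rewrite leqn0 => /eqP ->.
  rewrite leq_eqVlt => /predU1P[->//|]; rewrite ltnS => /IHl kl p /kl pl /=.
  by case: (svalP (next l (S l))) => + _ _; apply.
have S_col k l p q : p \in sval (S k) -> q \in sval (S l) ->
    col p.1 q.1 = col p.2 q.2.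
  move=> pk ql; have [[s_iso _ _] _] := svalP (S (maxn k l)).
  by apply: s_iso; [apply: S_incr pk|apply: S_incr ql];
    rewrite ?leq_maxl ?leq_maxr.
have S_mem k : e k \in unzip1 (sval (S k.+1)) /\ e k \in unzip2 (sval (S k.+1)).
  by have [] := svalP (next k (S k)).
have fP x : {y | exists k, (x, y) \in sval (S k)}.
  apply: cid; have [k ek] := e_surj x.
  have [/mapP[[x' y] xy /= xx'] _] := S_mem k.
  by exists y, k.+1; rewrite -ek xx'.
have gP y : {x | exists k, (x, y) \in sval (S k)}.
  apply: cid; have [k ek] := e_surj y.
  have [_ /mapP[[x y'] xy /= yy']] := S_mem k.
  by exists x, k.+1; rewrite -ek yy'.
have S_inj k l p q : p \in sval (S k) -> q \in sval (S l) ->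
    (p.1 == q.1) = (p.2 == q.2).
  by move=> pk ql; rewrite -!(col_eqNone tree) (S_col k l).
exists (fun x => sval (fP x)), (fun y => sval (gP y)); split.
- move=> x; case: (fP x) => y /= [k xy]; case: (gP y) => x' /= [l x'y].
  by apply/eqP; rewrite (S_inj _ _ _ _ x'y xy)/=.
- move=> y; case: (gP y) => x /= [k xy]; case: (fP x) => y' /= [l xy'].
  by apply/eqP; rewrite -(S_inj _ _ _ _ xy' xy)/=.
- move=> x y; case: (fP x) => x' /= [k xx']; case: (fP y) => y' /= [l yy'].
  by rewrite (S_col _ _ _ _ xx' yy').
- move=> p ps; case: (fP p.1) => y /= [k py].
  by apply/eqP; rewrite -(S_inj k 0 (p.1, y) p)/=.
Qed.

Corollary pair_homogeneity (e : nat -> T) (e_surj : forall x, exists k, e k = x)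
    x y x' y' : x != y -> col x y = col x' y' -> col y x = col y' x' ->
  exists f g : T -> T, [/\ cancel f g, cancel g f,
    forall x y, col (f x) (f y) = col x y, f x = x' & f y = y'].
Proof.
move=> xy exy eyx.
have closed2 a b : center_closed [:: a; b].
  move=> m u v w; rewrite !inE /separates3.
  by do 3![case/orP => /eqP->]; rewrite eqxx ?andbF.
have [|//|f [g [fK gK f_col fs]]] := @back_and_forth e e_surj [:: (x, x'); (y, y')].
  split=> //= p q; rewrite !inE => /orP[] /eqP-> /orP[] /eqP-> //=;
  by rewrite !col_self.
exists f, g; split=> //.
  by rewrite (fs (x, x')) ?inE ?eqxx.
by rewrite (fs (y, y')) ?inE ?eqxx ?orbT.
Qed.

End ColoredTree.

(** * Automorphisms of a colored tree: pasting, commutators and tripods *)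

Section KaleidoscopicAction.
Variables (T : eqType) (C : eqType) (col : T -> T -> option C).
Variables (G : groupType) (act : G -> T -> T).

(** [act_faithful] and [act_full] identify [G] with the full automorphism group of [(T, col)];
    [act_enum] also provides a point of [T]. *)
Record kaleidoscopic_action : Prop := KaleidoscopicAction {
  act_one : forall x, act 1%g x = x;
  act_mul : forall g h x, act (g * h)%g x = act g (act h x);
  act_faithful : forall g h, (forall x, act g x = act h x) -> g = h;
  act_col : forall g x y, col (act g x) (act g y) = col x y;
  act_full : forall f g : T -> T, cancel f g -> cancel g f ->
    (forall x y, col (f x) (f y) = col x y) -> exists k, forall x, act k x = f x;
  act_enum : exists e : nat -> T, forall x, exists k, e k = x }.

Hypotheses (tree : kaleidoscopic_tree col) (action : kaleidoscopic_action).

Lemma actK g : cancel (act g) (act g^-1%g).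
Proof. by move=> x; rewrite -(act_mul action) mulVg (act_one action). Qed.

Lemma actKV g : cancel (act g^-1%g) (act g).
Proof. by move=> x; rewrite -(act_mul action) mulgV (act_one action). Qed.

Lemma act_inv_fix g x : act g x = x -> act g^-1%g x = x.
Proof. by move=> gx; rewrite -{1}gx actK. Qed.

Lemma act_pair x y x' y' : x != y -> col x y = col x' y' -> col y x = col y' x' ->
  exists g, act g x = x' /\ act g y = y'.
Proof.
move=> xy exy eyx; have [e e_surj] := act_enum action.
have [f [g [fK gK f_col fx fy]]] := pair_homogeneity tree e_surj xy exy eyx.
by have [k kf] := act_full action fK gK f_col; exists k; rewrite !kf.
Qed.

Section Paste.
Variables (J : Type) (v : J -> T) (l : C).
Hypothesis disj : forall j j' u,
  col (v j) u = Some l -> col (v j') u = Some l -> j = j'.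

Let paste_fun (r : J -> G) u :=
  if pselect (exists j, col (v j) u = Some l) is left e then act (r (sval (cid e))) u
  else u.

Let paste_in r j u : col (v j) u = Some l -> paste_fun r u = act (r j) u.
Proof.
move=> ju; rewrite /paste_fun; case: pselect => [e|[]]; last by exists j.
by case: cid => j' /= j'u; rewrite (disj j'u ju).
Qed.

Let paste_out r u : (forall j, col (v j) u <> Some l) -> paste_fun r u = u.
Proof.
move=> H; rewrite /paste_fun; case: pselect => // ex.
by have [j ju] := ex; case: (H j ju).
Qed.

Let in_or_out u : (exists j, col (v j) u = Some l) \/ (forall j, col (v j) u <> Some l).
Proof.
have [|H] := pselect (exists j, col (v j) u = Some l); first by left.
by right => j ju; apply: H; exists j.
Qed.

(** Points of a half-tree see any outside point as they see its root [v j], and an outside point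
    other than [v j] sees the half-tree as it sees [v j]. As [r j] fixes [v j], acting independently
    on the disjoint half-trees preserves colors. *)
Lemma act_paste (r : J -> G) : (forall j, act (r j) (v j) = v j) ->
  exists k, (forall j u, col (v j) u = Some l -> act k u = act (r j) u) /\
            (forall u, (forall j, col (v j) u <> Some l) -> act k u = u).
Proof.
move=> rv.
have stab (r' : J -> G) j u : (forall j, act (r' j) (v j) = v j) ->
    col (v j) u = Some l -> col (v j) (act (r' j) u) = Some l.
  by move=> r'v; rewrite -{2}(r'v j) (act_col action).
have cancelf (r1 r2 : J -> G) : (forall j, act (r1 j) (v j) = v j) ->
    (forall j, cancel (act (r1 j)) (act (r2 j))) ->
    cancel (paste_fun r1) (paste_fun r2).
  move=> r1v r12 u; have [[j ju]|out] := in_or_out u; last by rewrite !paste_out.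
  by rewrite (paste_in _ ju) (paste_in _ (stab r1 j u r1v ju)) r12.
have out_stab j u : col (v j) u <> Some l -> col (v j) (paste_fun r u) <> Some l.
  have [[j' ju]|out] := in_or_out u; last by rewrite paste_out.
  rewrite (paste_in _ ju) => nju jru; apply: nju.
  by rewrite (disj jru (stab r j' u rv ju)).
have mixed j u w : col (v j) u = Some l -> col (v j) w <> Some l ->
    col u w = col u (v j).
  move=> ju jw; apply: (col_tree tree); first exact: (col_Some_neq tree ju).
  by rewrite ju; apply/eqP.
have inout j u w : col (v j) u = Some l -> col (v j) w <> Some l ->
    col (paste_fun r u) (paste_fun r w) = col u w.
  move=> ju jw; rewrite (mixed j u w)// (mixed j (paste_fun r u))//; last 2 first.
  - by rewrite (paste_in _ ju); exact: stab.
  - exact: out_stab.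
  by rewrite (paste_in _ ju) -{1}(rv j) (act_col action).
have [|||k kf] := act_full action (f := paste_fun r)
    (g := paste_fun (fun j => (r j)^-1%g)).
- by apply: cancelf => // j; exact: actK.
- by apply: cancelf => j; [exact: act_inv_fix|exact: actKV].
- move=> u w; have [[j ju]|uout] := in_or_out u.
    have [jw|/eqP jw] := eqVneq (col (v j) w) (Some l); last exact: inout ju jw.
    by rewrite (paste_in _ ju) (paste_in _ jw) (act_col action).
  have [[j jw]|wout] := in_or_out w; last by rewrite !paste_out.
  rewrite (paste_out _ uout) (paste_in _ jw).
  have [<-|vu] := eqVneq (v j) u; first by rewrite jw stab.
  have side x : col (v j) x = Some l -> col u x = col u (v j).
    by move=> jx; apply: (col_tree tree); rewrite // jx eq_sym; apply/eqP.
  by rewrite !side// stab.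
exists k; split=> [j u ju|u uout]; rewrite kf; first exact: paste_in.
exact: paste_out.
Qed.
End Paste.

Lemma act_paste1 v l r : act r v = v ->
  exists k, (forall u, col v u = Some l -> act k u = act r u) /\
            (forall u, col v u <> Some l -> act k u = u).
Proof.
move=> rv; have [|k [kin kout]] := @act_paste unit (fun=> v) l _ (fun=> r) (fun=> rv).
  by move=> [] [].
by exists k; split=> u H; [exact: (kin tt)|exact: kout].
Qed.

Definition commutator_fixing z r := exists s t : G,
  [/\ act s z = z, act t z = z & r = (s * t * s^-1 * t^-1)%g].

(* The complement of the half-tree [col d u = Some i] lies in a half-tree [H]
   away from [z]; some [t] fixing [z] has pairwise disjoint translates [t^k H], and
   [r = s (t s t^-1)^-1] for [s] the infinite product of the [t^k r t^-k]. *)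
Lemma trivial_near_commutator z d i r : col d z = Some i ->
  (forall u, col d u = Some i -> act r u = u) -> commutator_fixing z r.
Proof.
move=> dz r_id; have [l1 [l0 [l2 /and3P[l10 l02 l12]]]] := col_three tree.
have Sneq (a b : C) : a != b -> Some a != Some b by apply: contraNneq => -[->].
have [e ed ez] := col_kaleidoscopic tree (col_Some_neq tree dz) l10.
have l20 : l2 != l0 by rewrite eq_sym.
(* [H] is the half-tree of color [l1] at [e], and [t] will move [e] to [e']. Seen from [e'], all of
   [H] has color [l2]; since [l2] differs from [l1], the translates of [H] are disjoint. *)
have [e' e'e e'z] := col_kaleidoscopic tree (col_Some_neq tree ez) l20.
have r_out u : col e u <> Some l1 -> act r u = u.
  move=> eu; apply: r_id; apply: contrapT => du; apply: eu.
  have [->//|ud] := eqVneq u d.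
  rewrite -ed; apply: (col_tree tree); first by rewrite eq_sym (col_Some_neq tree ed).
  have -> : col d e = Some i.
    rewrite -dz; apply/esym; apply: (col_tree tree); first exact: (col_Some_neq tree ed).
    by rewrite ed ez Sneq// eq_sym.
  exact/eqP.
have ze : col z e = col z e'.
  apply: (col_tree tree); first exact: (col_Some_neq tree e'z).
  by rewrite e'e e'z Sneq.
have zne : z != e by rewrite eq_sym (col_Some_neq tree ez).
have [|t [tz te]] := act_pair zne ze; first by rewrite ez e'z.
have shift u a : a != l0 -> col e u = Some a -> col e' u = Some l2.
  move=> al0 eu; rewrite -e'e; apply: (col_tree tree).
    by rewrite eq_sym (col_Some_neq tree e'e).
  have -> : col e e' = Some l0.
    rewrite -ez; apply/esym; apply: (col_tree tree); first exact: (col_Some_neq tree e'e).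
    by rewrite e'e e'z Sneq// eq_sym.
  by rewrite eu Sneq.
pose w k := act (t ^+ k)%g e.
have w0 : w 0 = e by rewrite /w expg0 (act_one action).
have wS k : w k.+1 = act t (w k) by rewrite /w expgS (act_mul action).
have shiftw k u a : a != l0 -> col (w k) u = Some a -> col (w k.+1) u = Some l2.
  move=> al0; have -> : w k.+1 = act (t ^+ k)%g e' by rewrite /w expgSr (act_mul action) te.
  by rewrite -(actKV (t ^+ k)%g u) !(act_col action); exact: shift.
have later k j u : col (w k) u = Some l1 -> col (w (k + j.+1)) u = Some l2.
  move=> ku; elim: j => [|j IHj]; first by rewrite addn1; exact: shiftw ku.
  by rewrite addnS; exact: shiftw IHj.
have disj k k' u : col (w k) u = Some l1 -> col (w k') u = Some l1 -> k = k'.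
  wlog lt : k k' / k < k'.
    by case: (ltngtP k k') => // ? H ? ?; [|apply/esym]; apply: H.
  move=> /(later _ (k' - k.+1)); rewrite addnS -addSn subnKC// => -> [e21].
  by move: l12; rewrite e21 eqxx.
have re : act r e = e by apply: r_out; rewrite col_self.
have [|s [s_in s_out]] := act_paste disj (r := fun k => (t ^+ k * r * t ^- k)%g).
  by move=> k; rewrite !(act_mul action) actK re.
have sz : act s z = z.
  apply: s_out => k; have -> : z = act (t ^+ k)%g z.
    elim: k => [|k IHk]; first by rewrite expg0 (act_one action).
    by rewrite expgSr (act_mul action) tz.
  by rewrite (act_col action) ez => -[e01]; move: l10; rewrite e01 eqxx.
exists s, t; split=> //.
(* Conjugating [s] by [t] shifts its factors by one and so leaves out the factor [r] of index 0. *)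
suff rts : (r * t * s = s * t)%g by rewrite -rts !mulgK.
apply: (act_faithful action) => y; rewrite !(act_mul action).
have wt k u : col (w k.+1) (act t u) = col (w k) u by rewrite wS (act_col action).
have [[k ky]|yout] := pselect (exists k, col (w k) y = Some l1).
  have kty : col (w k.+1) (act t y) = Some l1 by rewrite wt.
  rewrite (s_in _ _ ky) (s_in _ _ kty) expgS invgM !(act_mul action) actK.
  apply: r_out; rewrite -w0 => w0y.
  suff : 0 = k.+1 by [].
  apply: disj w0y _; rewrite wt /w (act_col action) -re (act_col action).
  by rewrite -ky /w -{2}(actKV (t ^+ k)%g y) (act_col action).
have {}yout k : col (w k) y <> Some l1 by move=> ky; apply: yout; exists k.
rewrite (s_out _ yout).
have [ety|ety] := eqVneq (col e (act t y)) (Some l1).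
  by rewrite -w0 in ety; rewrite (s_in _ _ ety) expg0 invg1 mul1g mulg1.
rewrite r_out ?s_out//; last exact/eqP.
by case=> [|k]; [rewrite w0; apply/eqP|rewrite wt].
Qed.

Lemma commutator_fixing_fix z r : commutator_fixing z r -> act r z = z.
Proof.
by case=> s [t [sz tz ->]]; rewrite !(act_mul action) !act_inv_fix// tz.
Qed.

(* [p] and [q] turn the tripod (x, y, z) with centre colours (i, j, k) into the
   tripod (x, y, z') with centre colours (j, i, k). *)
Lemma tripod_flip i j k : i != j -> j != k -> i != k ->
  exists x y z (p q : G),
    [/\ commutator_fixing x p, commutator_fixing y q,
        commutator_fixing z (p * q)%g,
        exists m, [/\ col m x = Some i, col m y = Some j & col m z = Some k] &
        exists m, [/\ col m x = Some j, col m y = Some i &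
                      col m (act q z) = Some k]].
Proof.
move=> ij jk ik.
have Sneq (a b : C) : a != b -> Some a != Some b by apply: contraNneq => -[->].
have ji : j != i by rewrite eq_sym.
have [e0 _] := act_enum action.
have [b ab] := col_leafless tree (e0 0) i; set a := e0 0 in ab.
have {}ab : a != b := col_Some_neq tree ab.
(* [m] and [m'] both lie between [a] and [b], with opposite colors; [d] and [d'] will hang from them
   in the direction [k]. *)
have [m ma mb] := col_kaleidoscopic tree ab ij.
have [m' m'a m'b] := col_kaleidoscopic tree ab ji.
have hang n : exists d, [/\ col n d = Some k & col d n = Some i].
  have [u nu] := col_leafless tree n k.
  have [d dn du] := col_kaleidoscopic tree (col_Some_neq tree nu) ij.
  exists d; split=> //; rewrite -nu; apply/esym; apply: (col_tree tree).
    exact: (col_Some_neq tree dn).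
  by rewrite dn du Sneq.
have off_center n d a' l : col n d = Some k -> col n a' = Some l -> l != k ->
    col d a' = col d n /\ col a' d = col a' n.
  move=> nd na lk; apply: (gate_vals tree).
  - exact: (col_Some_neq tree nd).
  - exact: (col_Some_neq tree na).
  - by rewrite na nd Sneq.
have between n l l' : col n a = Some l -> col n b = Some l' -> l != l' ->
    col a n = col a b /\ col b n = col b a.
  move=> na nb ll'; have [] := gate_vals tree (v := n) (f := a) (u := b).
  - exact: (col_Some_neq tree nb).
  - exact: (col_Some_neq tree na).
  - by rewrite na nb Sneq.
  by move=> -> ->.
have [d [md dm]] := hang m; have [d' [m'd d'm]] := hang m'.
have [da ad] := off_center _ _ _ _ md ma ik.
have [db bd] := off_center _ _ _ _ md mb jk.
have [d'a ad'] := off_center _ _ _ _ m'd m'a jk.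
have [d'b bd'] := off_center _ _ _ _ m'd m'b ik.
have [am bm] := between _ _ _ ma mb ij.
have [am' bm'] := between _ _ _ m'a m'b ji.
have da_ : d != a by apply: (col_Some_neq tree (i := i)); rewrite da.
have db_ : d != b by apply: (col_Some_neq tree (i := i)); rewrite db.
(* [h1] and [h2] both carry [d] to [d']; the first fixes [a] and the second fixes [b]. *)
have [|| h1 [h1d h1a]] := act_pair da_ (x' := d') (y' := a).
- by rewrite da d'a dm.
- by rewrite ad ad' am.
have [|| h2 [h2d h2b]] := act_pair db_ (x' := d') (y' := b).
- by rewrite db d'b dm.
- by rewrite bd bd' bm.
have other (o : option C) : exists l, o != Some l.
  have [oi|] := eqVneq o (Some i); last by exists i.
  by exists j; rewrite oi Sneq.
(* The half-trees of [x] at [a], of [y] at [b] and of [z] at [d] point away from the rest of the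
   tripod, so that elements can be corrected on one of them at a time. *)
have [la abl] := other (col a b); have [lb bal] := other (col b a).
have [x ax] := col_leafless tree a la; have [y bY] := col_leafless tree b lb.
have [z dz] := col_leafless tree d j.
have [k2 [k2in k2out]] := act_paste1 lb (act_inv_fix h2b).
have [k1 [k1in k1out]] := act_paste1 la (act_inv_fix h1a).
(* Undoing [h2] near [y] and [h1] near [x] gives elements trivial there that still carry [d] to
   [d']. *)
pose q := (h2 * k2)%g; pose p1 := (h1 * k1)%g.
have qd : act q d = d'.
  by rewrite (act_mul action) k2out ?h2d// bd bm; apply/eqP.
have p1d : act p1 d = d'.
  by rewrite (act_mul action) k1out ?h1d// ad am; apply/eqP.
have k3d : act (p1^-1 * q)%g d = d by rewrite (act_mul action) qd -p1d actK.
(* [k3] corrects [p1] near [z] only: [p'] agrees with [q] there and stays trivial near [x]. *)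
have [k3 [k3in k3out]] := act_paste1 j k3d.
pose p' := (p1 * k3)%g.
have p'q u : col d u = Some j -> act p' u = act q u.
  by move=> du; rewrite (act_mul action) k3in// -(act_mul action) mulVKg.
have q_id u : col b u = Some lb -> act q u = u.
  by move=> bu; rewrite (act_mul action) k2in// actKV.
have p'_id u : col a u = Some la -> act p' u = u.
  move=> au; rewrite (act_mul action) k3out.
    by rewrite (act_mul action) k1in// actKV.
  have -> : col d u = col d a.
    apply: (col_tree tree); first by rewrite eq_sym.
    by rewrite au ad am eq_sym.
  by rewrite da dm => -[e]; rewrite e eqxx in ij.
exists x, y, z, (p'^-1)%g, q; split.
- by apply: (trivial_near_commutator ax) => u /p'_id; exact: act_inv_fix.
- exact: (trivial_near_commutator bY).
- apply: (trivial_near_commutator dz) => u du.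
  by rewrite (act_mul action) -p'q// actK.
- exists m; split.
  + rewrite -ma; apply: (col_tree tree); last by rewrite ax am eq_sym.
    by rewrite eq_sym (col_Some_neq tree ma).
  + rewrite -mb; apply: (col_tree tree); last by rewrite bY bm eq_sym.
    by rewrite eq_sym (col_Some_neq tree mb).
  + rewrite -md; apply: (col_tree tree); last by rewrite dz dm Sneq.
    by rewrite eq_sym (col_Some_neq tree md).
- exists m'; split.
  + rewrite -m'a; apply: (col_tree tree); last by rewrite ax am' eq_sym.
    by rewrite eq_sym (col_Some_neq tree m'a).
  + rewrite -m'b; apply: (col_tree tree); last by rewrite bY bm' eq_sym.
    by rewrite eq_sym (col_Some_neq tree m'b).
  + rewrite -m'd; apply: (col_tree tree).
      by rewrite eq_sym (col_Some_neq tree m'd).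
    by rewrite -{1}qd (act_col action) dz d'm Sneq.
Qed.
End KaleidoscopicAction.

Local Open Scope ring_scope.

(** * The median cocycle and its evaluation on bar chains *)

Section MedianCocycle.
Variables (T : eqType) (C : eqType) (col : T -> T -> option C).
Hypothesis tree : kaleidoscopic_tree col.

(** All points that [m] does not see in the direction of [m'] have one color at [m'], and at least
    two of the three points are such. *)
Lemma center_unique m m' x y z :
  separates3 col m x y z -> separates3 col m' x y z -> m = m'.
Proof.
rewrite /separates3 => /and3P[xy yz xz] /and3P[xy' yz' xz'].
apply/eqP; apply: contraT => mm'.
have same w : col m w != col m m' -> col m' w = col m' m.
  by move=> mw; apply: (col_tree tree).
have [ex|/same ex] := eqVneq (col m x) (col m m').
  move: xy' xz'; rewrite -?ex => xy' xz'.
  have /same ey : col m y != col m m' by rewrite -ex eq_sym.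
  have /same ez : col m z != col m m' by rewrite -ex eq_sym.
  by rewrite ey ez eqxx in yz'.
have [ey|/same ey] := eqVneq (col m y) (col m m').
  have /same ez : col m z != col m m' by rewrite -ey eq_sym.
  by rewrite ex ez eqxx in xz'.
by rewrite ex ey eqxx in xy'.
Qed.

Definition alternating (h : option C -> option C -> int) := forall a b, h a b = - h b a.

Variable h : option C -> option C -> int.
Hypothesis h_alt : alternating h.

Lemma alternating_diag a : h a a = 0.
Proof. by have := h_alt a a; lia. Qed.

Definition cyclic_sum a b c := h a b + h b c + h c a.

(* The sum over all [m] of the coboundaries of [h (col m x) (col m y)]: only the
   centre of x, y, z contributes. *)
Definition median_cocycle x y z : int :=
  if pselect (exists m, separates3 col m x y z) is left e then
    let m := sval (cid e) in cyclic_sum (col m x) (col m y) (col m z)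
  else 0.

Lemma cyclic_sum0 m x y z : ~~ separates3 col m x y z ->
  cyclic_sum (col m x) (col m y) (col m z) = 0.
Proof.
rewrite /separates3 /cyclic_sum !negb_and !negbK => /or3P[]/eqP->;
rewrite alternating_diag.
- by rewrite (h_alt (col m y) (col m z)); lia.
- by rewrite (h_alt (col m x) (col m z)); lia.
- by rewrite (h_alt (col m y) (col m z)); lia.
Qed.

Lemma median_cocycleE m x y z : separates3 col m x y z ->
  median_cocycle x y z = cyclic_sum (col m x) (col m y) (col m z).
Proof.
move=> sep; rewrite /median_cocycle; case: pselect => [e|ne]; last by case: ne; exists m.
by case: cid => m' /= sep'; rewrite (center_unique sep sep').
Qed.

Lemma median_cocycle0 x y z : (forall m, ~~ separates3 col m x y z) ->
  median_cocycle x y z = 0.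
Proof.
move=> sep; rewrite /median_cocycle; case: pselect => // e.
by have [m sepm] := e; have := sep m; rewrite sepm.
Qed.

(** Several triples can share one index set [S], and the cocycle identity is then checked term by
    term. *)
Lemma median_cocycle_sum (S : seq T) x y z : uniq S ->
  (forall m, separates3 col m x y z -> m \in S) ->
  median_cocycle x y z = \sum_(m <- S) cyclic_sum (col m x) (col m y) (col m z).
Proof.
move=> S_uniq S_sep.
have [[m sep]|nosep] := pselect (exists m, separates3 col m x y z).
  rewrite (median_cocycleE sep) (bigD1_seq m)//=; last exact: S_sep.
  rewrite big1 ?addr0// => m' m'm; apply: cyclic_sum0.
  by apply: contra m'm => sep'; rewrite (center_unique sep sep').
have {}nosep m : ~~ separates3 col m x y z.
  by apply/negP => sep; apply: nosep; exists m.
by rewrite median_cocycle0// big1// => m _; exact: cyclic_sum0.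
Qed.

Lemma median_cocycle_cocycle x y z w :
  median_cocycle y z w - median_cocycle x z w + median_cocycle x y w
  - median_cocycle x y z = 0.
Proof.
have center a b c : exists s : seq T, forall m, separates3 col m a b c -> m \in s.
  have [[m sep]|nosep] := pselect (exists m, separates3 col m a b c).
    by exists [:: m] => m' sep'; rewrite (center_unique sep sep') inE.
  by exists [::] => m sep; case: nosep; exists m.
have [s1 H1] := center y z w; have [s2 H2] := center x z w.
have [s3 H3] := center x y w; have [s4 H4] := center x y z.
pose S := undup (s1 ++ s2 ++ s3 ++ s4).
have S_uniq : uniq S by exact: undup_uniq.
rewrite (median_cocycle_sum S_uniq (x := y)); last first.
  by move=> m /H1 ms; rewrite mem_undup !mem_cat ms ?orbT.
rewrite (median_cocycle_sum S_uniq (y := z)); last first.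
  by move=> m /H2 ms; rewrite mem_undup !mem_cat ms ?orbT.
rewrite (median_cocycle_sum S_uniq (z := w)); last first.
  by move=> m /H3 ms; rewrite mem_undup !mem_cat ms ?orbT.
rewrite (median_cocycle_sum S_uniq); last first.
  by move=> m /H4 ms; rewrite mem_undup !mem_cat ms ?orbT.
rewrite -sumrB -big_split -sumrB big1// => m _.
rewrite /cyclic_sum /= (h_alt (col m w) (col m y)) (h_alt (col m z) (col m x)).
lia.
Qed.

Lemma median_cocycle_diag12 x y : median_cocycle x x y = 0.
Proof. by apply: median_cocycle0 => m; rewrite /separates3 eqxx. Qed.

Lemma median_cocycle_diag23 x y : median_cocycle x y y = 0.
Proof. by apply: median_cocycle0 => m; rewrite /separates3 eqxx andbF. Qed.

Variables (G : groupType) (act : G -> T -> T).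
Hypothesis action : kaleidoscopic_action col act.

Lemma median_cocycle_act g x y z :
  median_cocycle (act g x) (act g y) (act g z) = median_cocycle x y z.
Proof.
have sepE m : separates3 col (act g m) (act g x) (act g y) (act g z) =
    separates3 col m x y z by rewrite /separates3 !(act_col action).
have [[m sep]|nosep] := pselect (exists m, separates3 col m x y z).
  rewrite (median_cocycleE sep) (@median_cocycleE (act g m)) ?sepE//.
  by rewrite !(act_col action).
have {}nosep m : ~~ separates3 col m x y z.
  by apply/negP => sep; apply: nosep; exists m.
rewrite !median_cocycle0// => m.
by rewrite -(actKV action g m) sepE.
Qed.

(** The pullback of the median cocycle along the orbit map of [x], in inhomogeneous form. *)
Definition cocycle_chain x : {freeg (G * G) / int} -> int :=
  fglift (fun p : G * G => median_cocycle x (act p.1 x) (act (p.1 * p.2)%g x) : int^o).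

Fact cocycle_chain_is_zmod_morphism x : zmod_morphism (cocycle_chain x).
Proof. exact: (lift_is_additive (M := int^o)). Qed.
HB.instance Definition _ x := GRing.isZmodMorphism.Build _ _ (cocycle_chain x)
  (cocycle_chain_is_zmod_morphism x).

Lemma cocycle_chainU x g k : cocycle_chain x << (g, k) >> =
  median_cocycle x (act g x) (act (g * k)%g x).
Proof. by rewrite /cocycle_chain liftU scale1r. Qed.

Lemma cocycle_chain_bar3 x u : cocycle_chain x (bar3 u) = 0.
Proof.
pose zero : {freeg (G * G * G) / int} -> int := \0.
apply: (freeg_additive_eq (f := cocycle_chain x \o @bar3 G) (g := zero)) => -[[a b] c].
rewrite /= /bar3 liftU scale1r !(raddfB, raddfD) /= !cocycle_chainU.
rewrite -(median_cocycle_act a x (act b x)) -!(act_mul action) mulgA.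
exact: median_cocycle_cocycle.
Qed.

(** The prism cochain between the orbit maps of [x] and [y]: its coboundary is the difference of the
    two pullbacks. *)
Definition base_change x y : {freeg G / int} -> int :=
  fglift (fun g : G =>
    median_cocycle x (act g x) (act g y) - median_cocycle x y (act g y) : int^o).

Fact base_change_is_zmod_morphism x y : zmod_morphism (base_change x y).
Proof. exact: (lift_is_additive (M := int^o)). Qed.
HB.instance Definition _ x y := GRing.isZmodMorphism.Build _ _ (base_change x y)
  (base_change_is_zmod_morphism x y).

Lemma base_changeU x y g : base_change x y << g >> =
  median_cocycle x (act g x) (act g y) - median_cocycle x y (act g y).
Proof. by rewrite /base_change liftU scale1r. Qed.

Lemma cocycle_chain_base_change x y u :
  cocycle_chain x u = cocycle_chain y u + base_change x y (bar2 u).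
Proof.
apply: (freeg_additive_eq (f := cocycle_chain x)
  (g := cocycle_chain y \+ (base_change x y \o @bar2 G))) => -[g k].
rewrite /= /bar2 liftU scale1r !(raddfB, raddfD) /= !cocycle_chainU !base_changeU.
rewrite -(median_cocycle_act g x (act k x)) -(median_cocycle_act g x y (act k y)).
rewrite -!(act_mul action).
(* These are the three tetrahedra of the prism over [(x, g x, g k x)] and [(y, g y, g k y)]. *)
have := median_cocycle_cocycle x (act g x) (act (g * k)%g x) (act (g * k)%g y).
have := median_cocycle_cocycle x (act g x) (act g y) (act (g * k)%g y).
have := median_cocycle_cocycle x y (act g y) (act (g * k)%g y).
lra.
Qed.

Lemma cocycle_chain_cycle x y u : bar2 u = 0 -> cocycle_chain x u = cocycle_chain y u.
Proof. by move=> u0; rewrite (cocycle_chain_base_change x y) u0 raddf0 addr0. Qed.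
End MedianCocycle.

(** * Bar 2-cycles built from tripods *)

Section BarCycles.
Variables (T : eqType) (C : eqType) (col : T -> T -> option C).
Variables (G : groupType) (act : G -> T -> T).
Hypotheses (tree : kaleidoscopic_tree col) (action : kaleidoscopic_action col act).

Lemma bar2U (g k : G) : bar2 << (g, k) >> = << k >> - << (g * k)%g >> + << g >>.
Proof. by rewrite /bar2 liftU scale1r. Qed.

(** The chain encodes the relation [r (t s) = s t]. In each of its three simplices the first element
    fixes [z], so the cocycle meets a repeated vertex. *)
Lemma commutator_fixing_chain z r : commutator_fixing act z r ->
  exists u : {freeg (G * G) / int}, bar2 u = << r >> /\
    forall h, alternating h -> cocycle_chain col h act z u = 0.
Proof.
case=> s [t [sz tz ->]].
pose r' := (s * t * s^-1 * t^-1)%g; rewrite -/r'.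
have rts : (r' * (t * s) = s * t)%g by rewrite /r' !mulgA mulgVK mulgVK.
exists (<< (r', (t * s)%g) >> + << (t, s) >> - << (s, t) >>); split.
  rewrite !(raddfB, raddfD) /= !bar2U rts.
  by apply/eqP/freeg_eqP => x; rewrite !(coeffB, coeffD); ring.
have r'z : act r' z = z.
  by rewrite !(act_mul action) !(act_inv_fix action)// tz.
move=> h h_alt; rewrite !(raddfB, raddfD) /= !cocycle_chainU.
by rewrite r'z sz tz !median_cocycle_diag12//; ring.
Qed.

Lemma tripod_cycle x0 i j k : i != j -> j != k -> i != k ->
  exists u : {freeg (G * G) / int}, bar2 u = 0 /\
    forall h, alternating h -> cocycle_chain col h act x0 u =
      cyclic_sum h (Some i) (Some j) (Some k) - cyclic_sum h (Some j) (Some i) (Some k).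
Proof.
move=> ij jk ik.
have [x [y [z [p [q [px qy pqz [m [mx my mz]] [m' [m'x m'y m'z]]]]]]]] :=
  tripod_flip tree action ij jk ik.
have [up [bp cp]] := commutator_fixing_chain px.
have [uq [bq cq]] := commutator_fixing_chain qy.
have [us [bs cs]] := commutator_fixing_chain pqz.
have {}px := commutator_fixing_fix action px.
have {}qy := commutator_fixing_fix action qy.
have {}pqz := commutator_fixing_fix action pqz.
pose u := up + uq - us - << (p, q) >>.
have bu : bar2 u = 0.
  rewrite !(raddfB, raddfD) /= bp bq bs bar2U.
  by apply/eqP/freeg_eqP => v; rewrite !(coeffB, coeffD, coeff0); ring.
exists u; split=> // h h_alt.
have tripod n a b c a' b' c' : col n a = Some a' -> col n b = Some b' ->
    col n c = Some c' -> a' != b' -> b' != c' -> a' != c' ->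
    median_cocycle col h a b c = cyclic_sum h (Some a') (Some b') (Some c').
  move=> na nb nc ab bc ac.
  rewrite (@median_cocycleE _ _ _ tree h n) ?na ?nb ?nc//.
  rewrite /separates3 na nb nc; apply/and3P.
  by split; [move: ab|move: bc|move: ac]; apply: contraNneq => -[->].
have ji : j != i by rewrite eq_sym.
rewrite -(tripod _ _ _ _ _ _ _ mx my mz)// -(tripod _ _ _ _ _ _ _ m'x m'y m'z)//.
(* On a cycle the base point may be taken to be [x]. The chains [uq] and [us] vanish at [y] and [z];
   moving them to [x] leaves one base change term each. *)
rewrite (cocycle_chain_cycle tree h_alt action x0 x bu) !(raddfB, raddfD) /= cp//.
rewrite (cocycle_chain_base_change tree h_alt action x y) cq// bq.
rewrite (cocycle_chain_base_change tree h_alt action x z) cs// bs.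
rewrite cocycle_chainU !base_changeU qy pqz px.
rewrite !median_cocycle_diag12// !median_cocycle_diag23//.
have -> : median_cocycle col h x (act (p * q)%g x) z =
    median_cocycle col h x (act q x) (act q z).
  rewrite -(median_cocycle_act tree h action p x (act q x)) px.
  by rewrite -!(act_mul action) pqz.
rewrite -(median_cocycle_act tree h action q x y z) qy.
(* The value is now [omega (x, q x, y) - omega (x, q x, q z)], which this identity turns into
   [omega (q x, y, q z) - omega (x, y, q z)]. *)
have := median_cocycle_cocycle tree h_alt x (act q x) y (act q z).
lra.
Qed.
End BarCycles.

(** * Descent of functionals to homology, and lower bounds for the rank *)

Section HomologyFunctional.
Variables (U V W A : zmodType) (f : {additive U -> V}) (g : {additive V -> W}).
Variables (w : {additive V -> A}).
Hypothesis w_boundary : forall u, w (f u) = 0.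

Definition homology_eval (x : homology f g) : A := w (cycle_val (repr x)).

Lemma homology_evalE (z : Defs.cycle g) :
  homology_eval (\pi_(Quotient.quot (@boundary_pred U V W f g))%qT z) = w (cycle_val z).
Proof.
rewrite /homology_eval; set z' := repr _.
have : z' - z \in @boundary_pred U V W f g.
  rewrite Quotient.idealrBE; apply/eqP.
  by rewrite /z' reprK.
case/asboolP => u fu; apply/eqP; rewrite -subr_eq0 -raddfB.
by rewrite -[_ - _]/(cycle_val (z' - z)) -fu w_boundary.
Qed.

Fact homology_eval_is_zmod_morphism : zmod_morphism homology_eval.
Proof.
move=> x y; rewrite -[x]reprK -[y]reprK -raddfB !homology_evalE.
by rewrite -raddfB.
Qed.
End HomologyFunctional.

Section TensorFunctional.
Variables (A : zmodType) (w : {additive A -> int}).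

Definition free_eval : {freeg (A * rat) / int} -> rat :=
  fglift (fun p : A * rat => (w p.1)%:~R * p.2 : zmodule rat).

Fact free_eval_is_zmod_morphism : zmod_morphism free_eval.
Proof. exact: (lift_is_additive (M := zmodule rat)). Qed.
HB.instance Definition _ := GRing.isZmodMorphism.Build _ _ free_eval
  free_eval_is_zmod_morphism.

Lemma free_evalU a r : free_eval << (a, r) >> = (w a)%:~R * r.
Proof. by rewrite /free_eval liftU scale1r. Qed.

Lemma free_eval_span x : x \in zspan_pred (@tensor_relations A rat) -> free_eval x = 0.
Proof.
move=> /asboolP /(_ [set y | free_eval y = 0]%classic); apply; split.
  split=> /= [|y z y0 z0]; first by rewrite raddf0.
  by rewrite (raddfB free_eval) /= y0 z0 subr0.
move=> _ [[a [a' [b ->]]]|[a [b [b' ->]]]] /=; rewrite !raddfB /= !free_evalU.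
  by rewrite raddfD /= intrD; ring.
by ring.
Qed.

Lemma free_eval_scale r x : free_eval (free_scale r x) = r * free_eval x.
Proof.
apply: (freeg_additive_eq (f := free_eval \o @free_scale A r)
  (g := r \*o free_eval)) => -[a q].
by rewrite /= /free_scale liftU scale1r !free_evalU /=; ring.
Qed.

Definition tensor_eval (t : tensorQ A) : rat := free_eval (repr t).

Lemma tensor_evalE x : tensor_eval (tensorQ_pi x) = free_eval x.
Proof.
apply/eqP; rewrite -subr_eq0 -raddfB; apply/eqP/free_eval_span.
by apply/tensorQ_pi_eq; rewrite tensorQ_piK.
Qed.

Fact tensor_eval_is_scalar : scalar tensor_eval.
Proof.
move=> r t u; rewrite -[t]tensorQ_piK -[u]tensorQ_piK.
rewrite -[_ *: _]/(tensorQ_scale r (tensorQ_pi (repr t))) tensorQ_scaleE -raddfD.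
by rewrite !tensor_evalE raddfD /= free_eval_scale.
Qed.
HB.instance Definition _ := GRing.isLinear.Build _ _ _ _ tensor_eval
  tensor_eval_is_scalar.
End TensorFunctional.

(** The pairing matrix is [a] times the identity and factors through [d] coordinates, so its rank is
    at most [d]. *)
Lemma is_basis_card (K : fieldType) (V : lmodType K) (I : finType)
    (psi : I -> {scalar V}) (y : I -> V) (a : K) : a != 0 ->
  (forall i j, psi i (y j) = a *+ (i == j)) ->
  forall d (v : 'I_d -> V), is_basis v -> (#|I| <= d)%N.
Proof.
move=> a0 psi_y d v [_ gen].
have [M yM] := boolp.choice (fun j : 'I_#|I| => gen (y (enum_val j))).
pose P := \matrix_(j < #|I|, i < d) M j i.
pose Q := \matrix_(i < d, j < #|I|) psi (enum_val j) (v i).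
have PQ : P *m Q = a%:M.
  apply/matrixP => j j'; rewrite !mxE.
  transitivity (psi (enum_val j') (y (enum_val j))).
    rewrite yM linear_sum; apply: eq_bigr => i _.
    by rewrite !mxE scalarZ.
  by rewrite psi_y (inj_eq enum_val_inj) eq_sym.
have <- : \rank (P *m Q) = #|I|.
  by rewrite PQ mxrank_unit // unitmxE det_scalar unitfE expf_neq0.
exact: leq_trans (mxrankM_maxl _ _) (rank_leq_col _).
Qed.

Lemma rank_lower_bound (A : zmodType) (I : finType) (psi : I -> {additive A -> int})
    (y : I -> A) (a : int) : a != 0 ->
  (forall i j, psi i (y j) = a *+ (i == j)) -> enat_le (Some #|I|) (rank A).
Proof.
move=> a0 psi_y; rewrite /rank /dimension.
(* Without a finite basis the default [None] makes the rank infinite. *)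
case: xgetP => [[k|//] _ [d [v [[->] v_basis]]]|//] /=.
apply: (@is_basis_card rat (tensorQ A) I (fun i => tensor_eval (psi i))
  (fun j => tensorQ_pi << (y j, 1) >>) a%:~R _ _ d v v_basis).
  by rewrite intr_eq0.
by move=> i j; rewrite /= tensor_evalE free_evalU psi_y mulr1 rmorphMn.
Qed.

Lemma card_ltn_pairs N : #|{: {p : 'I_N * 'I_N | (p.1 < p.2)%N}}| = 'C(N, 2).
Proof.
rewrite card_sig -sum1_card -(pair_big_dep predT (fun i j : 'I_N => (i < j)%N) (fun _ _ => 1%N))/=.
rewrite (exchange_big_dep predT)//= -bin2_sum big_mkord; apply: eq_bigr => j _.
by rewrite (big_ord_narrow (ltnW (ltn_ord j))) sum1_card card_ord.
Qed.

(** * Independent classes indexed by pairs of colors *)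

Section RankH2.
Variables (T : eqType) (C : eqType) (col : T -> T -> option C).
Variables (G : groupType) (act : G -> T -> T).
Hypotheses (tree : kaleidoscopic_tree col) (action : kaleidoscopic_action col act).

Definition color_pair_form (a b : C) (u v : option C) : int :=
  ((u == Some a) && (v == Some b))%:R - ((u == Some b) && (v == Some a))%:R.

Lemma color_pair_form_alternating a b : alternating (color_pair_form a b).
Proof. by move=> u v; rewrite /color_pair_form opprB; congr (_%:R - _%:R); rewrite andbC. Qed.

Theorem rank_H2_lower_bound N (o : C) (cf : 'I_N -> C) : injective cf ->
  (forall i, cf i != o) -> enat_le (Some 'C(N, 2)) (rank (H2 G)).
Proof.
move=> cf_inj cfo; rewrite -card_ltn_pairs.
have [e _] := act_enum action; pose x0 := e 0%N.
pose I := ({p : 'I_N * 'I_N | (p.1 < p.2)%N} : finType).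
pose form (p : I) := color_pair_form (cf (val p).1) (cf (val p).2).
have cycle_ex (p : I) : {u : {freeg (G * G) / int} | bar2 u = 0 /\
    forall h, alternating h -> cocycle_chain col h act x0 u =
      cyclic_sum h (Some o) (Some (cf (val p).1)) (Some (cf (val p).2)) -
      cyclic_sum h (Some (cf (val p).1)) (Some o) (Some (cf (val p).2))}.
  apply: cid; apply: tripod_cycle => //; try by rewrite eq_sym.
  by rewrite (inj_eq cf_inj) neq_ltn (valP p).
pose psi p := homology_eval (f := @bar3 G) (g := @bar2 G) (cocycle_chain col (form p) act x0).
have bd p u : cocycle_chain col (form p) act x0 (bar3 u) = 0.
  by apply: cocycle_chain_bar3 => //; exact: color_pair_form_alternating.
have ker p : sval (cycle_ex p) \in ker_pred (@bar2 G).
  by case: cycle_ex => u /= [u0 _]; apply/eqP.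
pose y p : H2 G :=
  \pi_(Quotient.quot (@boundary_pred _ _ _ (@bar3 G) (@bar2 G)))%qT (Cycle (ker p)).
have y_val p q : homology_eval (cocycle_chain col (form p) act x0) (y q) =
    cocycle_chain col (form p) act x0 (sval (cycle_ex q)).
  by rewrite /y (homology_evalE (bd p)).
pose psi' p := (HB.pack (psi p : H2 G -> int)
  (GRing.isZmodMorphism.Build (H2 G) int (psi p)
    (homology_eval_is_zmod_morphism (bd p))) : {additive H2 G -> int}).
(* The forms vanish on [o], so the difference of cyclic sums is [h j k - h k j], whence the constant
   2. *)
apply: (@rank_lower_bound (H2 G) I psi' y 2) => // p q.
rewrite -[LHS]/(homology_eval (cocycle_chain col (form p) act x0) (y q)) y_val.
have [_ ->] := svalP (cycle_ex q); last exact: color_pair_form_alternating.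
rewrite /cyclic_sum /form /color_pair_form.
have Some_cf i j : (Some (cf i) == Some (cf j)) = (i == j) by exact: (inj_eq cf_inj).
have Some_o i : (Some o == Some (cf i)) = false.
  by rewrite [LHS](inj_eq (@Some_inj _)) eq_sym (negPf (cfo i)).
rewrite !Some_cf !Some_o !andbF /=.
have swap : ((val q).1 == (val p).2) && ((val q).2 == (val p).1) = false.
  apply/negP => /andP[/eqP e1 /eqP e2].
  have := valP q; rewrite e1 e2 => /(ltn_trans (valP p)).
  by rewrite ltnn.
have same : ((val q).1 == (val p).1) && ((val q).2 == (val p).2) = (p == q).
  have -> : (p == q) = (val q == val p) by rewrite eq_sym.
  by case: (val q) (val p) => [a b] [a' b']; rewrite xpair_eqE.
rewrite [((val q).2 == (val p).1) && _]andbC [((val q).2 == (val p).2) && _]andbC.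
by rewrite swap same; case: (p == q).
Qed.
End RankH2.

Local Open Scope classical_set_scope.
Local Open Scope card_scope.
Local Open Scope ring_scope.

(** * Branches, cut points and arcs *)

Section BranchTopology.
Variable X : topologicalType.
Hypotheses (X_conn : connected [set: X]) (X_haus : hausdorff_space X).
Hypothesis X_lc : locally_connected X.

Lemma branch_at_refl (x y : X) : y <> x -> branch_at x y y.
Proof. by move=> yx; exact: connected_component_refl. Qed.

Lemma branch_at_sym (x y z : X) : branch_at x y z -> branch_at x z y.
Proof. exact: connected_component_sym. Qed.

Lemma branch_at_trans (x y z w : X) :
  branch_at x y z -> branch_at x z w -> branch_at x y w.
Proof. exact: connected_component_trans. Qed.

Lemma branch_at_neq (x y z : X) : branch_at x y z -> z <> x.
Proof. exact: connected_component_sub. Qed.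

Lemma branch_at_connected (x y z : X) (C : set X) :
  connected C -> C y -> C z -> ~ C x -> branch_at x y z.
Proof.
move=> C_conn Cy Cz Cx; apply: (connected_component_max Cy _ C_conn) => // t Ct.
by move=> tx; apply: Cx; rewrite -tx.
Qed.

Lemma open_branch_at (x y : X) : open (branch_at x y).
Proof.
rewrite openE => p xyp.
have [|V [V_open Vp V_conn Vx]] := X_lc (x := p) (U := ~` [set x]).
  apply: open_nbhs_nbhs; split; last exact: branch_at_neq xyp.
  exact/closed_openC/accessible_closed_set1/hausdorff_accessible.
have : nbhs p V by exact: open_nbhs_nbhs.
apply: filterS => q Vq; apply: branch_at_trans xyp _.
by apply: branch_at_connected V_conn Vp Vq _ => /Vx; exact.
Qed.

(** Otherwise the branch would be clopen in the connected space [X]. *)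
Lemma closure_branch_at (x y : X) : y <> x -> closure (branch_at x y) x.
Proof.
move=> yx; apply: contrapT => ncl.
have : branch_at x y = [set: X].
  apply: X_conn; first by exists y; exact: branch_at_refl.
    by exists (branch_at x y); [exact: open_branch_at|rewrite setTI].
  exists (branch_at x y); last by rewrite setTI.
  rewrite closure_id; apply/seteqP; split=> [|p clp]; first exact: subset_closure.
  have px : p <> x by move=> px; apply: ncl; move: clp; rewrite px.
  have [|q [yq pq]] := clp (branch_at x p).
    apply: open_nbhs_nbhs; split; [exact: open_branch_at|exact: branch_at_refl].
  by apply: branch_at_trans yq _; exact: branch_at_sym.
by move/seteqP => [_ /(_ x I)] /branch_at_neq.
Qed.

(** The closure of the branch of [x] at [y] is connected, contains [x] and [y], and misses [z],
    whose branch at [y] is open and disjoint from it. *)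
Lemma branch_at_tree (x y z : X) :
  y <> x -> y <> z -> ~ branch_at y x z -> branch_at z y x.
Proof.
move=> yx yz yxz; have xy : x <> y by move=> e; apply: yx.
apply: (@branch_at_connected _ _ _ (closure (branch_at y x))).
- exact/connected_closure/component_connected.
- exact: closure_branch_at.
- exact/subset_closure/branch_at_refl.
have zy : z <> y by move=> e; apply: yz.
move=> /(_ (branch_at y z)) []; last first.
  by move=> q [xq zq]; apply/yxz/(branch_at_trans xq)/branch_at_sym.
by apply: open_nbhs_nbhs; split; [exact: open_branch_at|exact: branch_at_refl].
Qed.

Definition cuts (w x y : X) := [/\ w <> x, w <> y & ~ branch_at w x y].

Lemma cuts_sym w x y : cuts w x y -> cuts w y x.
Proof. by move=> [wx wy wxy]; split=> // /branch_at_sym. Qed.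

Lemma connected_cuts (w x y : X) (C : set X) :
  connected C -> C x -> C y -> cuts w x y -> C w.
Proof.
move=> C_conn Cx Cy [_ _]; apply: contra_notP => Cw.
exact: branch_at_connected C_conn Cx Cy Cw.
Qed.

Section Arcs.
Variable R : realType.

(** Continuity on the whole line avoids subspace topologies; it is obtained by precomposing with the
    retraction onto [0, 1]. *)
Definition arc_map (f : R -> X) (x y : X) :=
  [/\ continuous f, {in `[0, 1] &, injective f}, f 0 = x & f 1 = y].

Lemma is_arc_map (x y : X) (A : set X) : is_arc R x y A ->
  exists2 f, arc_map f x y & f @` `[0, 1]%classic = A.
Proof.
case=> f [f_cont f_inj f0 f1 fA].
pose clamp (t : R) := Num.max 0 (Num.min 1 t).
have clamp01 t : clamp t \in `[0, 1].
  rewrite in_itv /= /clamp le_max lexx /= ge_max ler01 ge_min lexx //.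
have clampK t : t \in `[0, 1] -> clamp t = t.
  by rewrite in_itv /= => /andP[t0 t1]; rewrite /clamp (min_idPr t1) (max_idPr t0).
have clamp_cont : continuous clamp.
  move=> t; apply: (@continuous_max R R (fun=> 0) (fun t => Num.min 1 t)).
    exact: cst_continuous.
  apply: (@continuous_min R R (fun=> 1) id) => //.
  exact: cst_continuous.
exists (f \o clamp); last first.
  rewrite -fA; apply/seteqP; split=> _ [t t01 <-] /=; last by exists t; rewrite /= ?clampK.
  by exists (clamp t) => //; exact: clamp01.
split.
- move=> t; have /subspace_continuousP/(_ (clamp t) (clamp01 t)) := f_cont.
  move=> ft U /ft /= Ut.
  have := clamp_cont t _ Ut; rewrite /= !nbhs_simpl /=.
  by apply: filterS => s /=; apply; exact: clamp01.
- by move=> s t s01 t01 /= /f_inj; rewrite clampK// clampK//; apply.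
- by rewrite /= clampK// in_itv /= lexx ler01.
- by rewrite /= clampK// in_itv /= lexx ler01.
Qed.

Lemma arc_map_connected f (x y : X) (s t : R) :
  arc_map f x y -> connected (f @` `[s, t]%classic).
Proof.
case=> f_cont _ _ _; apply: connected_continuous_connected.
  exact: segment_connected.
exact: continuous_subspaceT.
Qed.

Lemma arc_map_branch_lt f (x y : X) (r s t : R) : arc_map f x y ->
  0 <= s -> 0 <= t -> s < r -> t < r -> r <= 1 -> branch_at (f r) (f s) (f t).
Proof.
move=> f_arc; wlog st : s t / s <= t => [H|] s0 t0 sr tr r1.
  case: (leP s t) => [st|/ltW ts]; first exact: H.
  by apply: branch_at_sym; exact: H.
have [_ f_inj _ _] := f_arc.
apply: (branch_at_connected (arc_map_connected (s := s) (t := t) f_arc)).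
- by exists s => //=; rewrite in_itv /= lexx.
- by exists t => //=; rewrite in_itv /= lexx st.
case=> u /=; rewrite in_itv /= => /andP[su ut] /f_inj e.
by have ur : u = r; [apply: e; rewrite in_itv /=; lra|lra].
Qed.

Lemma arc_map_branch_gt f (x y : X) (r s t : R) : arc_map f x y ->
  s <= 1 -> t <= 1 -> r < s -> r < t -> 0 <= r -> branch_at (f r) (f s) (f t).
Proof.
move=> f_arc; wlog st : s t / s <= t => [H|] s0 t0 sr tr r1.
  case: (leP s t) => [st|/ltW ts]; first exact: H.
  by apply: branch_at_sym; exact: H.
have [_ f_inj _ _] := f_arc.
apply: (branch_at_connected (arc_map_connected (s := s) (t := t) f_arc)).
- by exists s => //=; rewrite in_itv /= lexx.
- by exists t => //=; rewrite in_itv /= lexx st.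
case=> u /=; rewrite in_itv /= => /andP[su ut] /f_inj e.
by have ur : u = r; [apply: e; rewrite in_itv /=; lra|lra].
Qed.

Lemma arc_map_cuts f (x y w : X) (s t : R) : arc_map f x y -> s <= t ->
  cuts w (f s) (f t) -> exists r, [/\ s < r, r < t & f r = w].
Proof.
move=> f_arc st cw.
have [||r /= + frw] := connected_cuts (arc_map_connected (s := s) (t := t) f_arc) _ _ cw.
- by exists s => //=; rewrite in_itv /= lexx.
- by exists t => //=; rewrite in_itv /= lexx st.
rewrite in_itv /= => /andP[sr rt]; have [ws wt _] := cw; exists r; split=> //.
  by rewrite lt_neqAle sr andbT; apply/eqP => e; apply: ws; rewrite e.
by rewrite lt_neqAle rt andbT; apply/eqP => e; apply: wt; rewrite -e.
Qed.

Lemma arc_map_neq f (x y : X) (s t : R) : arc_map f x y ->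
  0 <= s -> s < t -> t <= 1 -> f s <> f t.
Proof.
case=> _ f_inj _ _ s0 st t1 /f_inj e.
by have est : s = t; [apply: e; rewrite in_itv /=; lra|lra].
Qed.

Hypothesis arcs : forall x y : X, x <> y ->
  exists (f : R -> X) (t : R), [/\ arc_map f x y, 0 < t, t < 1 & branch_point (f t)].
Hypothesis branch_point_cut : forall x y : X, branch_point x -> branch_point y ->
  x <> y -> exists2 z, branch_point z & cuts z x y.

(* If [z] is a branch point of an arc from [x] to [y] and [z'] one of an arc from
   [x] to [z], a point cutting [z'] from [z] lies on both arcs. *)
Lemma point_cut x y : x <> y -> exists2 w, branch_point w & cuts w x y.
Proof.
move=> xy; have [f [t [f_arc t0 t1 z_br]]] := arcs xy.
have [_ _ f0 f1] := f_arc.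
have xz : x <> f t by rewrite -f0; apply: (arc_map_neq f_arc) => //; exact: ltW.
have [g [t' [g_arc t'0 t'1 z'_br]]] := arcs xz.
have [_ _ g0 g1] := g_arc.
have z'z : g t' <> f t by rewrite -g1; apply: (arc_map_neq g_arc) => //; exact: ltW.
have [w w_br cw] := branch_point_cut z'_br z_br z'z.
exists w => //.
have [r [t'r r1 gr]] : exists r, [/\ t' < r, r < 1 & g r = w].
  by apply: (arc_map_cuts g_arc); [exact: ltW|rewrite g1].
have r0 : 0 < r by lra.
have wxz' : branch_at w x (g t').
  by rewrite -gr -g0; apply: (arc_map_branch_lt g_arc) => //; lra.
have cwx : cuts w x (f t).
  have [_ wz wz'z] := cw; split=> //.
    by rewrite -gr -g0; apply: nesym; apply: (arc_map_neq g_arc) => //; lra.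
  by move=> wxz; apply: wz'z; apply: branch_at_trans wxz; exact: branch_at_sym.
have [r' [r'0 r't fr']] : exists r', [/\ 0 < r', r' < t & f r' = w].
  by apply: (arc_map_cuts f_arc); [exact: ltW|rewrite f0].
have wzy : branch_at w (f t) y.
  by rewrite -fr' -f1; apply: (arc_map_branch_gt f_arc) => //; lra.
have [wx wz wxz] := cwx; split=> //; first by apply: nesym; apply: branch_at_neq wzy.
by move=> wxy; apply: wxz; apply: branch_at_trans wxy _; exact: branch_at_sym.
Qed.

Lemma cuts_branch w x y z : cuts w x y -> branch_at w y z -> cuts w x z.
Proof.
move=> [wx wy wxy] wyz; split=> //; first exact/nesym/(branch_at_neq wyz).
by move=> wxz; apply: wxy; apply: branch_at_trans wxz _; exact: branch_at_sym.
Qed.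

(* The union [L] of the [branch_at w y], for [w] cutting [m] from [y], is open, and
   [L] together with [m] is closed; so [L] contains the branch of [y] at [m]. *)
Lemma branch_at_cuts (m y p : X) : branch_at m y p -> y <> m ->
  exists w, [/\ branch_point w, cuts w m y & branch_at w y p].
Proof.
move=> myp ym.
pose L := [set p | exists w, [/\ branch_point w, cuts w m y & branch_at w y p]].
have L_open : open L.
  rewrite openE => q [w [w_br cw wq]].
  have : nbhs q (branch_at w y).
    by apply: open_nbhs_nbhs; split=> //; exact: open_branch_at.
  by apply: filterS => q' wq'; exists w.
have [f [_ [f_arc _ _ _]]] := arcs (nesym ym).
have [f_cont f_inj f0 f1] := f_arc.
have L_closure q : q <> m -> closure L q -> L q.
  move=> qm clq.
  have [[U V] /= [Um Vq] [U_open V_open UV]] : exists2 AB : set X * set X,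
      (m \in AB.1 /\ q \in AB.2) & [/\ open AB.1, open AB.2 & AB.1 `&` AB.2 == set0].
    by have := X_haus; rewrite open_hausdorff; apply; apply/eqP/nesym.
  have {}Vq : V q by rewrite -in_setE.
  have {}Um : U m by rewrite -in_setE.
  have [|W [W_open Wq W_conn WV]] := X_lc (x := q) (U := V).
    exact: open_nbhs_nbhs.
  have [|q' [[w' [w'_br cw' w'q'] Wq']]] := clq W; first exact: open_nbhs_nbhs.
  have [r' [r'0 r'1 fr']] : exists r', [/\ 0 < r', r' < 1 & f r' = w'].
    by apply: (arc_map_cuts f_arc); rewrite ?f0 ?f1.
  have [d /= d0 fU] : exists2 d : R, 0 < d & forall t, `|t| < d -> U (f t).
    have : nbhs (f 0) U by rewrite f0; exact: open_nbhs_nbhs.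
    move=> /f_cont /nbhs_ballP [d /= d0 dU]; exists d => // t td; apply: dU.
    by rewrite /ball /= sub0r normrN.
  (* Up to [s] the arc stays in [U] and has not reached [w']. A cut point [w] found there is outside
     [W], so [W] keeps [q'] and [q] in one branch at [w]. *)
  pose s := Num.min (d / 2) (r' / 2).
  have s0 : 0 < s by rewrite lt_min !divr_gt0.
  have sd : s < d by rewrite gt_min; apply/orP; left; lra.
  have sr' : s < r' by rewrite gt_min; apply/orP; right; lra.
  have [w w_br cw] : exists2 w, branch_point w & cuts w (f 0) (f s).
    by apply: point_cut; apply: (arc_map_neq f_arc) => //; lra.
  have [r [r0 rs fr]] := arc_map_cuts f_arc (ltW s0) cw.
  have wsy : branch_at w (f s) y.
    by rewrite -fr -f1; apply: (arc_map_branch_gt f_arc) => //; lra.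
  have cwmy : cuts w m y by move: (cuts_branch cw wsy); rewrite f0.
  have Uw : U w by rewrite -fr; apply: fU; rewrite gtr0_norm//; lra.
  have wq' : branch_at w y q'.
    apply: (@branch_at_connected _ _ _ (branch_at w' y)) => //.
      exact: component_connected.
      by have [_ w'y _] := cw'; apply: branch_at_refl; exact: nesym.
    move=> w'w; have [_ _] := cw'; apply; apply: branch_at_trans (branch_at_sym w'w).
    by rewrite -fr' -f0 -fr; apply: (arc_map_branch_lt f_arc); lra.
  exists w; split=> //; apply: branch_at_trans wq' _.
  apply: (branch_at_connected W_conn) => // /WV Vw.
  by move/eqP/seteqP: UV => [/(_ w) + _]; apply.
have Ly : L y.
  have [w w_br cw] := point_cut (nesym ym).
  by exists w; split=> //; have [_ wy _] := cw; apply: branch_at_refl; exact: nesym.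
have H := @component_connected _ (~` [set m]) y (branch_at m y `&` L).
suff : branch_at m y `&` L = branch_at m y by move/seteqP => [_ /(_ p myp)[]].
apply: H.
- by exists y; split=> //; exact: branch_at_refl.
- by exists L.
- exists (closure L); first exact: closed_closure.
  apply/seteqP; split=> q [mq Lq]; split=> //; first exact: subset_closure.
  by apply: L_closure => //; exact: branch_at_neq mq.
Qed.

(** Otherwise some [w] would cut [f r] from [x] with [x] and [y] in one branch at [w]. But [w] lies
    on the arc before [f r], and the rest of the arc joins [f r] to [y] away from [w]. *)
Lemma arc_map_interior_cuts f (x y : X) (r : R) : arc_map f x y -> 0 < r -> r < 1 ->
  cuts (f r) x y.
Proof.
move=> f_arc r0 r1; have [_ _ f0 f1] := f_arc.
have rx : f r <> x by rewrite -f0; apply/nesym/(arc_map_neq f_arc) => //; lra.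
split=> //; first by rewrite -f1; apply: (arc_map_neq f_arc) => //; lra.
move=> /branch_at_cuts[|w [_ cw wxy]]; first exact: nesym.
have [s [s0 sr fs]] : exists s, [/\ 0 < s, s < r & f s = w].
  apply: (arc_map_cuts f_arc); first exact: ltW.
  by rewrite f0; exact: cuts_sym.
have [_ _] := cw; apply; apply: branch_at_trans (branch_at_sym wxy).
by rewrite -fs -f1; apply: (arc_map_branch_gt f_arc); lra.
Qed.

(* The centre is the last point of an arc from [x] to [y] that belongs to an arc
   from [x] to [z]. *)
Lemma center_exists (x y z : X) : x <> y -> y <> z -> x <> z ->
  [\/ cuts x y z, cuts y x z, cuts z x y |
      exists m, [/\ cuts m x y, cuts m y z & cuts m x z]].
Proof.
move=> xy yz xz; have [f [_ [f_arc _ _ _]]] := arcs xy.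
have [g [_ [g_arc _ _ _]]] := arcs xz.
have [f_cont f_inj f0 f1] := f_arc; have [g_cont g_inj g0 g1] := g_arc.
have seg0 : `[0, 1]%classic (0 : R) by rewrite /= in_itv /= lexx ler01.
pose S := (`[0, 1] `&` f @^-1` (g @` `[0, 1]))%classic.
have S_compact : compact S.
  apply: compact_closedI; first exact: segment_compact.
  apply: preimage_closed; first by move=> t _; exact: f_cont.
  apply: compact_closed => //; apply: continuous_compact.
    exact: continuous_subspaceT.
  exact: segment_compact.
have [||s sS s_max] := compact_EVT_max (f := idfun : R -> R) _ S_compact.
- by exists 0; split=> //; exists 0; rewrite ?g0.
- by apply: continuous_subspaceT => t; exact.
rewrite inE in sS; case: sS; rewrite /= in_itv /= => /andP[s0 s1] [u].
rewrite in_itv /= => /andP[u0 u1] gu.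
have mx : f s = x -> s = 0.
  by rewrite -f0 => /f_inj; apply; rewrite in_itv /= ?lexx ?ler01 ?s0.
(* Such a [w] would lie on both arcs, beyond [f s] on the first, against the maximality of [s]. By
   [branch_at_cuts], [f s] then cuts [y] from [z] when it differs from both. *)
have last w : cuts w (f s) y -> cuts w (f s) z -> False.
  move=> cwy cwz.
  have [r [sr r1 fr]] : exists r, [/\ s < r, r < 1 & f r = w].
    by apply: (arc_map_cuts f_arc) => //; rewrite f1.
  have [v [uv v1 gv]] : exists v, [/\ u < v, v < 1 & g v = w].
    by apply: (arc_map_cuts g_arc) => //; rewrite g1 gu.
  have /s_max : r \in S.
    rewrite inE; split; first by rewrite /= in_itv /=; lra.
    by exists v; rewrite /= ?fr// in_itv /=; lra.
  by rewrite /=; lra.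
have myz : y <> f s -> z <> f s -> cuts (f s) y z.
  move=> ym zm; split; [exact: nesym|exact: nesym|].
  by move=> /branch_at_cuts[//|w [_ cw wyz]]; exact: last cw (cuts_branch cw wyz).
have [e|mx'] := pselect (f s = x).
  by constructor 1; rewrite -e; apply: myz; rewrite e; exact: nesym.
have s_gt0 : 0 < s.
  by rewrite lt_neqAle s0 andbT; apply/eqP => e; apply: mx'; rewrite -e.
have u_gt0 : 0 < u.
  by rewrite lt_neqAle u0 andbT; apply/eqP => e; apply: mx'; rewrite -gu -e.
have [e|my] := pselect (f s = y).
  constructor 2; rewrite -e -gu; apply: (arc_map_interior_cuts g_arc) => //.
  by rewrite lt_neqAle u1 andbT; apply/eqP => u1'; apply: yz; rewrite -e -gu u1'.
have s_lt1 : s < 1.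
  by rewrite lt_neqAle s1 andbT; apply/eqP => e; apply: my; rewrite e.
have [e|mz] := pselect (f s = z).
  by constructor 3; rewrite -e; exact: (arc_map_interior_cuts f_arc).
have u_lt1 : u < 1.
  by rewrite lt_neqAle u1 andbT; apply/eqP => e; apply: mz; rewrite -gu e.
constructor 4; exists (f s); split.
- exact: (arc_map_interior_cuts f_arc).
- by apply: myz; exact: nesym.
- by rewrite -gu; exact: (arc_map_interior_cuts g_arc).
Qed.

End Arcs.
End BranchTopology.

Lemma cuts3_branch_point (X : topologicalType) (m x y z : X) :
  cuts m x y -> cuts m y z -> cuts m x z -> branch_point m.
Proof.
move=> [mx my mxy] [_ mz myz] [_ _ mxz].
pose f k := nth (branch_at m z) [:: branch_at m x; branch_at m y] k.
have neq u v : m <> v -> ~ branch_at m u v -> branch_at m u <> branch_at m v.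
  by move=> mv + e; apply; rewrite e; apply: branch_at_refl; exact: nesym.
have {}mxy := neq _ _ my mxy; have {}myz := neq _ _ mz myz.
have {}mxz := neq _ _ mz mxz.
rewrite /branch_point; apply: card_le_trans (subset_card_le (A := f @` `I_3) _).
  suff : f @` `I_3 #= `I_3 by move=> /card_eqPle[].
  apply: inj_card_eq => i j; rewrite !inE.
  by case: i => [|[|[|//]]]; case: j => [|[|[|//]]] //= _ _ e; exfalso;
    first [exact: mxy|exact: myz|exact: mxz|
      exact: (mxy (esym e))|exact: (myz (esym e))|exact: (mxz (esym e))].
move=> _ [[|[|k]] _ <-] /=; [exists x|exists y|exists z] => //; try exact: nesym.
by rewrite /f /= nth_nil.
Qed.

(** * The colored tree of branch points *)

Section BranchPointTree.
Variables (R : realType) (n : enat) (X : topologicalType) (c : coloring X n).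
Hypothesis n_ge3 : enat_le (Some 3%N) n.
Hypotheses (X_conn : connected [set: X]) (X_haus : hausdorff_space X).
Hypotheses (X_lc : locally_connected X) (X_compact : compact [set: X]).
Hypothesis X_metrizable : metrizable R X.
Variables (x1 x2 : X).
Hypothesis x12 : x1 <> x2.
Hypothesis arcs : forall x y : X, x <> y ->
  exists (f : R -> X) (t : R), [/\ arc_map f x y, 0 < t, t < 1 & branch_point (f t)].
Hypothesis c_kal : forall x y : X, branch_point x -> branch_point y -> x <> y ->
  forall i j : color n, i <> j ->
  exists z : X, [/\ z <> x, z <> y, branch_point z,
    c z (branch_at z x) = i & c z (branch_at z y) = j].

Definition branch_point_type := {x : X | `[< branch_point x >]}.
HB.instance Definition _ := Choice.on branch_point_type.
Implicit Types b : branch_point_type.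

Lemma branch_pointP b : branch_point (val b).
Proof. by case: b => x /= /asboolP. Qed.
Hint Resolve branch_pointP : core.

Definition mk_branch_point (x : X) (x_br : branch_point x) : branch_point_type :=
  exist _ x (asboolT x_br).

Definition point_col b (x : X) : option (color n) :=
  if x == val b then None else Some (c (val b) (branch_at (val b) x)).

Lemma point_colN b x : x <> val b ->
  point_col b x = Some (c (val b) (branch_at (val b) x)).
Proof. by move/eqP/negPf; rewrite /point_col => ->. Qed.

Lemma point_col_None b x : point_col b x = None -> x = val b.
Proof. by rewrite /point_col; case: eqP. Qed.

Lemma point_col_self b : point_col b (val b) = None.
Proof. by rewrite /point_col eqxx. Qed.

Lemma point_col_branch b x y : branch_at (val b) x y -> point_col b x = point_col b y.
Proof.
move=> bxy; have xb := branch_at_neq (branch_at_sym bxy); have yb := branch_at_neq bxy.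
by rewrite !point_colN// /branch_at (same_connected_component bxy).
Qed.

Lemma branch_of_point_col b x y : x <> val b -> point_col b x = point_col b y ->
  branch_at (val b) x y.
Proof.
move=> xb; have [->|/eqP yb] := eqVneq y (val b).
  by rewrite point_col_self => /point_col_None.
rewrite !point_colN// => -[e].
have [_ c_inj _] := coloring_bij c (branch_pointP b).
have -> : branch_at (val b) x = branch_at (val b) y.
  by apply: c_inj e; rewrite inE; [exists x|exists y].
exact: branch_at_refl.
Qed.

Lemma cuts_point_col b x y : cuts (val b) x y -> point_col b x != point_col b y.
Proof.
case=> bx _ nbr; apply/eqP => /branch_of_point_col; apply: contra_not nbr; apply.
exact: nesym.
Qed.

Lemma point_col_cuts b x y : x <> val b -> y <> val b -> point_col b x != point_col b y ->
  cuts (val b) x y.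
Proof.
move=> xb yb /eqP nxy; split; [exact: nesym|exact: nesym|].
by move/point_col_branch.
Qed.

Lemma point_col_onto b i : exists x, point_col b x = Some i.
Proof.
have [_ [x xb <-] ->] := local_actionP c i (branch_pointP b).
by exists x; rewrite point_colN.
Qed.

Lemma branch_point_cut (x y : X) : branch_point x -> branch_point y -> x <> y ->
  exists2 z, branch_point z & cuts z x y.
Proof.
move=> x_br y_br xy.
have [i [j ij]] : exists i j : color n, i <> j.
  have b0 : below n 0 by case: (n) n_ge3 => // k k3; exact: leq_trans k3.
  have b1 : below n 1 by case: (n) n_ge3 => // k k3; exact: leq_trans k3.
  by exists (exist _ 0%N b0), (exist _ 1%N b1).
have [z [zx zy z_br zi zj]] := c_kal x_br y_br xy ij.
exists z => //; apply: (@point_col_cuts (mk_branch_point z_br)); rewrite /=; try exact: nesym.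
by rewrite !point_colN /= ?zi ?zj; try exact: nesym; apply/eqP => -[].
Qed.

Let point_cut := point_cut arcs branch_point_cut.

Lemma point_col_inj (x y : X) : (forall b, point_col b x = point_col b y) -> x = y.
Proof.
move=> xy; apply: contrapT => /point_cut [w w_br cw].
have := @cuts_point_col (mk_branch_point w_br) _ _ cw.
by rewrite xy eqxx.
Qed.

Definition tree_col b b' := point_col b (val b').

Lemma branch_points_tree : kaleidoscopic_tree tree_col.
Proof.
split.
- move=> b b'; rewrite /tree_col; apply/eqP/eqP => [/point_col_None e|->].
    exact/val_inj.
  exact: point_col_self.
- move=> b b' b'' b'b'' nb; have [->|bb'] := eqVneq b b'; first by [].
  apply/esym/point_col_branch/branch_at_tree => //.
  + by apply/eqP; rewrite (inj_eq val_inj) eq_sym.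
  + by apply/eqP; rewrite (inj_eq val_inj).
  + by move/point_col_branch/eqP; apply/negP.
- move=> x y z xy yz xz.
  have neq (u v : branch_point_type) : u != v -> val u <> val v.
    by move=> uv /val_inj; exact/eqP.
  have sym (u v w : branch_point_type) : cuts (val u) (val v) (val w) ->
      tree_col u v != tree_col u w.
    exact: cuts_point_col.
  have nself (u v : branch_point_type) : u != v -> tree_col u u != tree_col u v.
    move=> uv; rewrite /tree_col point_col_self; apply/eqP => /esym/point_col_None/esym.
    exact: neq.
  (* A point that cuts the other two is itself the centre, with color [None]. *)
  case: (center_exists X_haus X_lc arcs branch_point_cut (neq _ _ xy) (neq _ _ yz) (neq _ _ xz)).
  + move=> cx; exists x; apply/and3P; split; [exact: nself|exact: sym|exact: nself].
  + by move=> cy; exists y; apply/and3P; split; [rewrite eq_sym|exact: nself|exact: sym];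
      rewrite ?nself// eq_sym.
  + by move=> cz; exists z; apply/and3P; split; [exact: sym|rewrite eq_sym|rewrite eq_sym];
      rewrite nself// eq_sym.
  + case=> m [mxy myz mxz].
    have m_br := cuts3_branch_point mxy myz mxz.
    by exists (mk_branch_point m_br); rewrite /separates3 !sym.
- move=> x y i j xy /eqP ij.
  have [|z [zx zy z_br zi zj]] := c_kal (branch_pointP x) (branch_pointP y) _ ij.
    by move=> /val_inj; exact/eqP.
  exists (mk_branch_point z_br).
    by rewrite /tree_col point_colN /= ?zi//; exact: nesym.
  by rewrite /tree_col point_colN /= ?zj//; exact: nesym.
- move=> b i; have [y bi] := point_col_onto b i.
  have [w w_br cw] : exists2 w, branch_point w & cuts w (val b) y.
    by apply: point_cut => e; move: bi; rewrite -e point_col_self.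
  exists (mk_branch_point w_br); rewrite -bi; apply: point_col_branch => /=.
  have [wb wy wby] := cw; apply: branch_at_tree => //.
  by apply: contra_not wby; exact: branch_at_sym.
- have below3 k : (k < 3)%N -> below n k.
    by case: (n) n_ge3 => // m /= m3 k3; exact: leq_trans m3.
  exists (exist _ 0%N (below3 0%N isT)), (exist _ 1%N (below3 1%N isT)),
    (exist _ 2%N (below3 2%N isT)).
  by [].
Qed.

(** A connected neighborhood contains every point cutting [x] from another of its points, and it is
    not reduced to [x], since it would be clopen. *)
Lemma branch_point_dense (x : X) (U : set X) : nbhs x U -> exists b, U (val b).
Proof.
move=> xU; have [V [V_open Vx V_conn VU]] := X_lc xU.
have [p [Vp px]] : exists p, V p /\ x <> p.
  apply: contrapT => single.
  have Vsingle : V = [set x].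
    apply/seteqP; split=> [p Vp|_ ->] //=; apply: contrapT => px.
    by apply: single; exists p; split=> //; exact: nesym.
  have V_closed : closed V.
    by rewrite Vsingle; exact/accessible_closed_set1/hausdorff_accessible.
  have VT : V = [set: X].
    by apply: X_conn; [exists x|exists V|exists V]; rewrite ?setTI.
  have V1 : V x1 by rewrite VT.
  have V2 : V x2 by rewrite VT.
  by apply: x12; move: V1 V2; rewrite Vsingle => -> ->.
have [w w_br cw] := point_cut px.
by exists (mk_branch_point w_br); apply/VU/(connected_cuts V_conn Vx Vp cw).
Qed.

(* A branch point is determined by three basic open sets contained in branches of
   distinct colors. *)
Lemma branch_points_enum : exists e : nat -> branch_point_type, forall b, exists k, e k = b.
Proof.
have [b0 _] := branch_point_dense (filterT : nbhs x1 [set: X]).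
suff [code code_inj] : exists code : branch_point_type -> nat, injective code.
  exists (fun k => if pselect (exists b, code b = k) is left e then sval (cid e) else b0).
  move=> b; exists (code b); case: pselect => [e|[]]; last by exists b.
  by case: cid => b' /= /code_inj.
have [M [f [g [fK gK f_cont g_cont]]]] := X_metrizable.
pose M' := HB.pack_for (pseudoPMetricType R) M (isPointed.Build M (f x1)).
have M_compact : compact [set: M].
  have -> : [set: M] = f @` [set: X].
    by apply/seteqP; split=> // y _; exists (g y).
  by apply: continuous_compact => //; exact: continuous_subspaceT.
have [B B_countable [B_open B_basis]] := @compact_second_countable R M' M_compact.
have [phi phi_inj] := elimT (countable_injP B) B_countable.
have [i [j [k /and3P[ij jk ik]]]] := col_three branch_points_tree.
have basic b l : exists V, exists p : branch_point_type,
    [/\ B V, V (f (val p)) & forall q, V (f (val q)) -> tree_col b q = Some l].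
  have [p bp] := col_leafless branch_points_tree b l.
  have [|V [BV Vp] VU] := B_basis (f (val p)) (g @^-1` branch_at (val b) (val p)).
    apply: open_nbhs_nbhs; split; last first.
      rewrite /= fK; apply: branch_at_refl => pb.
      by move: bp; rewrite /tree_col (pb : val p = val b) point_col_self.
    apply: open_comp => [y _|]; [exact: g_cont|exact: open_branch_at].
  exists V, p; split=> // q /VU /=; rewrite fK => /point_col_branch.
  by rewrite /tree_col => <-.
have [W WP] := choice (fun bl : branch_point_type * color n => basic bl.1 bl.2).
exists (fun b => pickle [:: phi (W (b, i)); phi (W (b, j)); phi (W (b, k))]).
move=> b b' /(pcan_inj pickleK) [ei ej ek].
(* Equal indices give equal basic sets, so [b] and [b'] are both centre of one triple [p], [q],
   [r]. *)
have Weq l : phi (W (b, l)) = phi (W (b', l)) ->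
    exists p, tree_col b p = Some l /\ tree_col b' p = Some l.
  have [p [BW Wp Wb]] := WP (b, l); have [p' [BW' _ Wb']] := WP (b', l).
  move=> /(phi_inj _ _ (mem_set BW) (mem_set BW')) e.
  by exists p; split; [exact: Wb|apply: Wb'; rewrite -e].
have [p [bp b'p]] := Weq _ ei; have [q [bq b'q]] := Weq _ ej.
have [r [br b'r]] := Weq _ ek.
have sep : separates3 (fun a a' : option (color n) => a') (Some i) (Some i) (Some j) (Some k).
  by apply/and3P; split; [move: ij|move: jk|move: ik]; apply: contraNneq => -[->].
apply: (@center_unique _ _ tree_col branch_points_tree b b' p q r).
  by rewrite /separates3 bp bq br; exact: sep.
by rewrite /separates3 b'p b'q b'r; exact: sep.
Qed.

(** * Extension of tree automorphisms to homeomorphisms *)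

Section Extension.
Variables (f g : branch_point_type -> branch_point_type).
Hypotheses (fK : cancel f g) (gK : cancel g f).
Hypothesis f_col : forall b b', tree_col (f b) (f b') = tree_col b b'.

(* [y] is a cluster point of the images of the branch points tending to [x]. *)
Lemma extension_exists x : exists y, forall b, point_col (f b) y = point_col b x.
Proof.
have [x_br|x_nbr] := pselect (branch_point x).
  by exists (val (f (mk_branch_point x_br))) => b; exact: f_col.
pose F := [set A | exists2 U, nbhs x U & forall b, U (val b) -> A (val (f b))].
have F_filter : ProperFilter F.
  split; first by move=> [U /branch_point_dense [b Ub]] /(_ b Ub).
  split.
  - by exists [set: X]; [exact: filterT|].
  - move=> A A' [U xU UA] [U' xU' UA']; exists (U `&` U'); first exact: filterI.
    by move=> b [Ub U'b]; split; [exact: UA|exact: UA'].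
  - move=> A A' AA' [U xU UA]; exists U => // b /UA; exact: AA'.
have xb b : x <> val b by move=> e; apply: x_nbr; rewrite e.
have near b : F [set q | point_col (f b) q = point_col b x].
  exists (branch_at (val b) x).
    by apply: open_nbhs_nbhs; split; [exact: open_branch_at|exact: branch_at_refl].
  by move=> b' /point_col_branch bb'; rewrite /= -/(tree_col _ _) f_col /tree_col -bb'.
have [y [_ y_cl]] := X_compact F_filter (filterT : F [set: X]).
have adherent b z : y = z -> z <> val (f b) -> point_col (f b) z = point_col b x.
  move=> <-{z} yb; have [|q [/= <-]] := y_cl _ (branch_at (val (f b)) y) (near b).
    by apply: open_nbhs_nbhs; split; [exact: open_branch_at|exact: branch_at_refl].
  exact: point_col_branch.
exists y => b; apply: (adherent) => // yb.
(* The case [y = val (f b)] is impossible: with [w] between [x] and [b], the image of [w] would give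
   [y] the color of [x] and also the different color of [b]. *)
have [w w_br cw] := point_cut (xb b).
set b' := mk_branch_point w_br.
have b'b : b' <> b by move=> e; have [_ + _] := cw; rewrite -e; apply.
have := cuts_point_col (cw : cuts (val b') x (val b)).
rewrite -(adherent b' (val (f b)) yb); last first.
  by move=> /val_inj /(can_inj fK) /esym.
by rewrite -/(tree_col _ _) f_col eqxx.
Qed.

Definition extension x := sval (cid (extension_exists x)).

Lemma extensionE b x : point_col (f b) (extension x) = point_col b x.
Proof. by rewrite /extension; case: cid. Qed.

(** By compactness it suffices that [extension x] is the only cluster point. Another one would be
    cut from it by a branch point, at which the images of points near [x] keep the color of
    [extension x]. *)
Lemma extension_continuous : continuous extension.
Proof.
move=> x; have F_filter : ProperFilter (extension @ x) by exact: fmap_proper_filter.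
have cl1 q : cluster (extension @ x) q -> q = extension x.
  move=> q_cl; apply: contrapT => /point_cut [w w_br cw].
  set b := mk_branch_point w_br.
  have [wq wx _] := cw.
  have xb : x <> val (g b).
    move=> e; apply: wx; have := extensionE (g b) x.
    by rewrite gK e point_col_self => /point_col_None.
  have near : (extension @ x) [set p | point_col b p = point_col b (extension x)].
    have : nbhs x (branch_at (val (g b)) x).
      by apply: open_nbhs_nbhs; split; [exact: open_branch_at|exact: branch_at_refl].
    apply: filterS => x' /point_col_branch.
    by rewrite /= -!(extensionE (g b)) gK => ->.
  have [|p [/= pe]] := q_cl _ (branch_at (val b) q) near.
    apply: open_nbhs_nbhs; split; first exact: open_branch_at.
    by apply: branch_at_refl; exact: nesym.
  move/(@point_col_branch b); rewrite pe; apply/eqP; exact: (@cuts_point_col b _ _ cw).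
apply: (@compact_cluster_set1 _ _ _ [set: X]) => //; [exact: filterT|exact: filterT|].
have [q [_ q_cl]] := X_compact F_filter (filterT : (extension @ x) [set: X]).
by apply/seteqP; split=> [p /cl1 //|_ ->] /=; rewrite -(cl1 _ q_cl).
Qed.
End Extension.

Local Notation K := (kaleidoscopic_group c (trivial_subgroup (Sym (color n)))).

Definition branch_point_act (k : K) b : branch_point_type :=
  mk_branch_point (homeo_branch_point (sg_val k) (branch_pointP b)).

Lemma point_col_act (k : K) b x :
  point_col (branch_point_act k b) (homeo_fun (sg_val k) x) = point_col b x.
Proof.
have k_inj := can_inj (homeoVK (sg_val k)).
have [->|/eqP xb] := eqVneq x (val b).
  by rewrite point_col_self; exact: (point_col_self (branch_point_act k b)).
rewrite !point_colN//; last by move=> /k_inj.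
have /asboolP/(_ _ (branch_pointP b))[s /eqP -> kb] := sg_valP k.
have := kb (c (val b) (branch_at (val b) x)).
rewrite local_actionE //; last by exists x.
by rewrite homeo_image_branch// => ->.
Qed.

(** The extensions of [f] and [g] are mutually inverse because a point is determined by its
    colors. *)
Lemma homeo_of_extension (f g : branch_point_type -> branch_point_type) :
  cancel f g -> cancel g f ->
  (forall b b', tree_col (f b) (f b') = tree_col b b') ->
  exists k : Homeo X, forall b x, point_col (f b) (k x) = point_col b x.
Proof.
move=> fK gK f_col.
have g_col b b' : tree_col (g b) (g b') = tree_col b b' by rewrite -f_col !gK.
pose s := extension fK f_col; pose t := extension gK g_col.
have st : cancel s t.
  move=> x; apply: point_col_inj => b.
  by rewrite -{1}(fK b) !extensionE.
have ts : cancel t s.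
  move=> x; apply: point_col_inj => b.
  by rewrite -{1}(gK b) !extensionE.
pose k := MkSym (asboolT (Bijective st ts)).
have kV : sym_fun (k^-1)%g = t.
  by apply: funext => x; apply: (can_inj st); rewrite -[LHS]/(k _) symKV ts.
have k_homeo : k \in group_of_closed (@homeo_closed X).
  by apply/asboolP; rewrite kV; split; exact: extension_continuous.
by exists (Subgroup k_homeo) => b x; exact: extensionE.
Qed.

Lemma branch_point_action : kaleidoscopic_action tree_col branch_point_act.
Proof.
split.
- by move=> b; exact/val_inj.
- by move=> k h b; exact/val_inj.
- move=> k h kh; apply/val_inj/val_inj/sym_eqP => x; apply: point_col_inj => b.
  have -> : b = branch_point_act k (branch_point_act k^-1%g b).
    by apply: val_inj => /=; rewrite -[RHS]/(homeo_fun _ (homeo_fun _ _)) homeoKV.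
  by rewrite point_col_act kh point_col_act.
- by move=> k b b'; rewrite /tree_col -[RHS](point_col_act k).
- move=> f g fK gK f_col.
  have [k kf] := homeo_of_extension fK gK f_col.
  have k_branch b : homeo_fun k (val b) = val (f b).
    by apply: point_col_None; rewrite kf point_col_self.
  have kK : k \in group_of_closed (@kaleidoscopic_closed X n c (trivial_subgroup (Sym (color n)))).
    apply/asboolP => x x_br; exists 1%g; first exact: eqxx.
    move=> i; have [C [y yx <-] ->] := local_actionP c i x_br.
    rewrite local_actionE //; last by exists y.
    rewrite homeo_image_branch// sym1E.
    pose b := mk_branch_point x_br.
    have := kf b y; rewrite (point_colN (b := b))// point_colN; last first.
      by rewrite -k_branch => /(can_inj (homeoVK k)).
    by rewrite -k_branch => -[].
  by exists (Subgroup kK) => b; apply: val_inj; exact: k_branch.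
- exact: branch_points_enum.
Qed.
End BranchPointTree.

(** * From Wazewski dendrites to the rank bound *)

Lemma metrizable_hausdorff (R : realType) (X : topologicalType) :
  metrizable R X -> hausdorff_space X.
Proof.
case=> M [f [g [fK _ f_cont _]]] p q pq; apply: (can_inj fK).
apply: (@metric_hausdorff R M) => A B /f_cont fA /f_cont fB.
by have [x [Ax Bx]] := pq _ _ fA fB; exists (f x).
Qed.

(** [arc] defaults to the empty set, so a point of [open_arc] also proves that an arc exists. *)
Lemma wazewski_arcs (R : realType) (n : enat) (X : topologicalType) :
  wazewski_dendrite R n X -> forall x y : X, x <> y ->
  exists (f : R -> X) (t : R), [/\ arc_map f x y, 0 < t, t < 1 & branch_point (f t)].
Proof.
case=> _ _ _ X_br x y /X_br [z [[xyz nxy] z_br]].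
have [[A A_arc]|no_arc] := pselect (exists A, is_arc R x y A); last first.
  by move: xyz; rewrite /Defs.arc xgetPN// => A A_arc; apply: no_arc; exists A.
have /is_arc_map [f f_arc fA] : is_arc R x y (Defs.arc R x y) := xgetI set0 A_arc.
move: xyz nxy z_br; rewrite -fA => -[t t01 <-] nxy z_br; exists f, t.
move: t01 nxy; rewrite /= in_itv /= => /andP[t0 t1] nxy.
have [_ _ f0 f1] := f_arc.
split=> //; rewrite lt_neqAle ?t0 ?t1 andbT; apply/eqP => e; apply: nxy.
  by left; rewrite -e.
by right; rewrite e.
Qed.

Close Scope card_scope.
Close Scope classical_set_scope.
Close Scope ring_scope.

Theorem corollary1p8 (R : realType) (n : enat) (n_ge3 : enat_le (Some 3) n)
    (X : topologicalType) (X_wazewski : wazewski_dendrite R n X)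
    (c : coloring X n) (c_kaleidoscopic : kaleidoscopic R c) :
  enat_le (half_product n)
    (rank (H2 (kaleidoscopic_group c (trivial_subgroup (Sym (color n)))))).
Proof.
have [[[_ X_compact X_conn X_met] [X_lc _]] [x1 [x2 x12]] _ _] := X_wazewski.
have X_haus := metrizable_hausdorff X_met.
have arcs := wazewski_arcs X_wazewski.
have c_kal (x y : X) : branch_point x -> branch_point y -> x <> y ->
    forall i j : color n, i <> j -> exists z : X, [/\ z <> x, z <> y, branch_point z,
      c z (branch_at z x) = i & c z (branch_at z y) = j].
  move=> x_br y_br xy i j ij.
  have [z [[_ nxy] z_br zi zj]] := c_kaleidoscopic x y x_br y_br xy i j ij.
  by exists z; split=> // e; apply: nxy; [left|right].
have tree := branch_points_tree n_ge3 X_conn X_haus X_lc arcs c_kal.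
have action := branch_point_action n_ge3 X_conn X_haus X_lc X_compact X_met x12 arcs c_kal.
have bound N (cf : 'I_N -> color n) (o : color n) : injective cf ->
    (forall i, cf i != o) -> enat_le (Some 'C(N, 2)) (rank (H2
      (kaleidoscopic_group c (trivial_subgroup (Sym (color n)))))).
  by move=> cf_inj cfo; exact: (rank_H2_lower_bound tree action cf_inj cfo).
have n_gt0 : below n 0 by case: (n) n_ge3 => // k k3; exact: leq_trans k3.
have big N : (forall i, (i < N)%N -> below n i.+1) -> enat_le (Some 'C(N, 2)) (rank (H2
    (kaleidoscopic_group c (trivial_subgroup (Sym (color n)))))).
  (* Color 0 is the fixed one; the others are the colors from 1 to [N]. *)
  move=> below_N; pose cf (i : 'I_N) : color n := exist _ i.+1 (below_N i (ltn_ord i)).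
  by apply: (bound N cf (exist _ 0%N n_gt0)) => [i j [/val_inj]|].
move: (rank _) big => rk; case: (n) => [k|] big /=.
  have -> : ((k - 1) * (k - 2) %/ 2)%N = 'C(k - 1, 2).
    by rewrite bin2 -divn2; congr (_ * _ %/ 2)%N; rewrite -subn1 -subnDA.
  by apply: big => i ik /=; lia.
(* For infinite [n], a finite rank [r] is excluded by [N = r.+2], since ['C(r.+2, 2) > r]. *)
case: rk big => //= r /(_ r.+2 (fun _ _ => isT)).
by rewrite binS bin1; lia.
Qed.
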